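(* Given an AAPTA $\mathcal{A}=\langle Q,q_0,\delta,\omega\rangle$ over a finite alphabet $\Sigma$, one can build a non-alternating AAPTA (nAAPTA) $\mathcal{N}$ with $\mathcal{L}(\mathcal{N})=\mathcal{L}(\mathcal{A})$, whose size is bounded by $\langle 2^{1+|Q|^2+2(|Q|\cdot|\omega|+1)\cdot\log(|Q|\cdot|\omega|+1)},\ 2^{N}\cdot\big((N-1)!\cdot(|\delta|_E+1)^{N-1}\cdot|\delta|_U^{N^2}\big)^{|\delta|_E},\ N\cdot|\delta|_E,\ |\delta|_U^{N},\ 2(|Q|\cdot|\omega|+1)\rangle$, where $N=|Q|\cdot|\delta|_B$.
   Context: Multisets: a multiset over a set $S$ is a map $\mu:S\to\mathbb{N}$; $\mu\sqsubseteq\mu'$ iff $\mu(s)\le\mu'(s)$ for all $s$; $(\mu\ominus\mu')(s)=\max(0,\mu(s)-\mu'(s))$; $\mathrm{supp}(\mu)=\{s:\mu(s)>0\}$; $|\mu|=\sum_s\mu(s)$. An EU-pair over $S$ is $\langle E;U\rangle$ with $E$ a finite multiset over $S$ and $U\subseteq S$; a multiset $\mu$ satisfies it if $E\sqsubseteq\mu$ and $\mathrm{supp}(\mu\ominus E)\subseteq U$. An EU-constraint over $S$ is a positive boolean formula built from $\top,\bot$, EU-pairs over $S$, $\wedge,\vee$. Markings: a marking of $S'$ by $S$ is a map $\nu:S'\to 2^S$; a unitary submarking is a map $\nu':S'\to S$ with $\nu'(s')\in\nu(s')$ for all $s'$; its image multiset is $s\mapsto|\{s':\nu'(s')=s\}|$.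 $\nu$ satisfies $\langle E;U\rangle$ if some unitary submarking has image multiset satisfying it; extended to EU-constraints ($\top$ always, $\bot$ never, $\wedge,\vee$ as usual, with possibly different submarkings for different conjuncts). Trees: a $D$-tree ($D$ finite) is a prefix-closed $t\subseteq D^*$ with root $\varepsilon$; successors of $n$ are the $n\cdot d\in t$; branches are maximal root-paths (finite or infinite). A $\Sigma$-labelled tree is $(t,l)$ with $t$ a $D$-tree for some finite $D$ and $l:t\to\Sigma$. Automata: an AAPTA over $\Sigma$ is $\langle Q,q_0,\delta,\omega\rangle$, $Q$ finite, $q_0\in Q$, $\delta:Q\times\Sigma\to$ EU-constraints over $Q$, $\omega:Q\to\mathbb{N}$; it is non-alternating (nAAPTA) if each $\delta(q,\sigma)$ is a disjunction of EU-pairs (or $\top$/$\bot$). An execution tree over $(t,l)$ is a $(D\times Q)$-tree whose node $(d_1,q_1)\cdots(d_k,q_k)$ is labelled $(d_1\cdots d_k,q_k)$ (a node of $t$), root labelled $(\varepsilon,q_0)$, such that for each node $x$ labelled $(m,q)$ the marking $\nu_x(m\cdot d)=\{q':x\cdot(d,q')\text{ is a node}\}$ of the successors of $m$ satisfies $\delta(q,l(m))$. It is accepting if on every infinite branch the least priority seen infinitely often is even. $\mathcal{L}(\mathcal{A})$ is the set of trees with an accepting execution tree. Size: $\langle |Q|,|\delta|_B,|\delta|_E,|\delta|_U,|\omega|\rangle$ with $|\delta|_B$ the maximum size of the formulas $\delta(q,\sigma)$, $|\delta|_E$ and $|\delta|_U$ the maximum of $|E|$ and of $|U|$ over EU-pairs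 in $\delta$, $|\omega|$ the number of distinct priorities.
   Formalization: In the second bound, |δ|_U is replaced by max(1,|δ|_U): when |δ|_U = 0 < |δ|_E the printed bound equals 0, which no automaton meets since every formula has size at least 1 (e.g. one state q0 with δ = ⟨{q0};∅⟩); otherwise the bounds agree. *)

(* Defs.v *)
From HB Require Import structures.
From mathcomp Require Import all_boot.
Set Implicit Arguments.
Unset Strict Implicit.
Unset Printing Implicit Defensive.

(* Multisets are only needed over finite sets (of states). *)
Section Multisets.
Variable S : finType.

Definition multiset := {ffun S -> nat}.
Implicit Types mu : multiset.

Definition msub mu mu' : bool := [forall s, mu s <= mu' s].
Definition mdiff mu mu' : multiset := [ffun s => mu s - mu' s].
Definition msupp mu : {set S} := [set s | 0 < mu s].
Definition mcard mu : nat := \sum_s mu s.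

End Multisets.

Section EUConstraints.
Variable S : finType.

Record eu_pair := EUPair { eu_E : multiset S; eu_U : {set S} }.

Definition mset_sat (mu : multiset S) (p : eu_pair) : bool :=
  msub (eu_E p) mu && (msupp (mdiff mu (eu_E p)) \subset eu_U p).

Inductive eu_constraint :=
  | EUTop
  | EUBot
  | EUAtom of eu_pair
  | EUAnd of eu_constraint & eu_constraint
  | EUOr of eu_constraint & eu_constraint.

Section Markings.
Variable S' : finType.

Definition marking := S' -> {set S}.

Definition unitary_submarking (nu : marking) (nu' : S' -> S) : Prop :=
  forall s', nu' s' \in nu s'.

Definition image_multiset (nu' : S' -> S) : multiset S :=
  [ffun s => #|[set s' | nu' s' == s]|].

Fixpoint marking_sat (nu : marking) (f : eu_constraint) : Prop :=
  match f with
  | EUTop => True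
  | EUBot => False
  | EUAtom p => exists2 nu', unitary_submarking nu nu'
                           & mset_sat (image_multiset nu') p
  | EUAnd f1 f2 => marking_sat nu f1 /\ marking_sat nu f2
  | EUOr f1 f2 => marking_sat nu f1 \/ marking_sat nu f2
  end.

End Markings.

(* Number of nodes of the syntax tree.  An EU-pair counts for one: the sizes
   of its two components are measured separately. *)
Fixpoint eu_size (f : eu_constraint) : nat :=
  match f with
  | EUTop | EUBot | EUAtom _ => 1
  | EUAnd f1 f2 | EUOr f1 f2 => (eu_size f1 + eu_size f2).+1
  end.

Fixpoint eu_pairs (f : eu_constraint) : seq eu_pair :=
  match f with
  | EUTop | EUBot => [::]
  | EUAtom p => [:: p]
  | EUAnd f1 f2 | EUOr f1 f2 => eu_pairs f1 ++ eu_pairs f2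
  end.

Fixpoint pair_disjunction (f : eu_constraint) : bool :=
  match f with
  | EUAtom _ => true
  | EUOr f1 f2 => pair_disjunction f1 && pair_disjunction f2
  | _ => false
  end.

Definition nonalternating_constraint (f : eu_constraint) : bool :=
  match f with
  | EUTop | EUBot => true
  | _ => pair_disjunction f
  end.

End EUConstraints.

Arguments EUTop {S}.
Arguments EUBot {S}.

(* A node is the word of directions leading to it from the root, so that
   [rcons n d] is the successor of [n] in direction [d]. *)
Record dtree (D : finType) := DTree {
  node :> pred (seq D);
  node_root : node [::];
  node_prefix : forall u v : seq D, node (u ++ v) -> node u
}.

(* The values of [label] outside [tree] are irrelevant: nothing below
   depends on them. *)
Record labelled_tree (Sigma : Type) := LabelledTree {
  dir : finType;
  tree : dtree dir;
  label : seq dir -> Sigma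
}.

Arguments label {Sigma} l n.

Record aapta (Sigma : finType) := AAPTA {
  state : finType;
  init : state;
  delta : state -> Sigma -> eu_constraint state;
  priority : state -> nat
}.

Arguments delta {Sigma} a q s.
Arguments priority {Sigma} a q.

Section Semantics.
Variables (Sigma : finType) (A : aapta Sigma) (T : labelled_tree Sigma).

Definition exec_word := seq (dir T * state A).

(* The node (d_1,q_1)...(d_k,q_k) of an execution tree is labelled with the
   pair (d_1...d_k, q_k), and the root with the pair (empty word, init). *)
Definition exec_node (x : exec_word) : seq (dir T) := unzip1 x.
Definition exec_state (x : exec_word) : state A := last (init A) (unzip2 x).

(* The successors of m, each identified with its last direction. *)
Definition successor (m : seq (dir T)) : finType :=
  {d : dir T | tree T (rcons m d)}.

Definition exec_marking (e : dtree (dir T * state A)%type) (x : exec_word) :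
    marking (state A) (successor (exec_node x)) :=
  fun d => [set q' | e (rcons x (val d, q'))].

Arguments exec_marking : clear implicits.

Definition execution_tree (e : dtree (dir T * state A)%type) : Prop :=
  forall x, e x ->
    tree T (exec_node x) /\
    marking_sat (exec_marking e x)
      (delta A (exec_state x) (label T (exec_node x))).

Definition infinitely_often (u : nat -> nat) (p : nat) : Prop :=
  forall i, exists2 j, i <= j & u j = p.

Definition parity_even (u : nat -> nat) : Prop :=
  exists p, [/\ infinitely_often u p,
                forall p', infinitely_often u p' -> p <= p'
              & ~~ odd p].

Definition infinite_branch (e : dtree (dir T * state A)%type)
    (b : nat -> dir T * state A) : Prop :=
  forall i, e (mkseq b i).

Definition accepting (e : dtree (dir T * state A)%type) : Prop :=
  forall b, infinite_branch e b ->
    parity_even (fun i => priority A (exec_state (mkseq b i))).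

Definition language : Prop :=
  exists2 e : dtree (dir T * state A)%type, execution_tree e & accepting e.

End Semantics.

Section Size.
Variables (Sigma : finType) (A : aapta Sigma).

Definition nonalternating : Prop :=
  forall q s, nonalternating_constraint (delta A q s).

Definition nb_states : nat := #|state A|.

Definition delta_B : nat := \max_(q : state A) \max_s eu_size (delta A q s).

Definition delta_E : nat :=
  \max_(q : state A) \max_s \max_(p <- eu_pairs (delta A q s)) mcard (eu_E p).

Definition delta_U : nat :=
  \max_(q : state A) \max_s \max_(p <- eu_pairs (delta A q s)) #|eu_U p|.

Definition nb_priorities : nat := size (undup (codom (priority A))).

End Size.

(* 2 ^ (1 + n^2 + 2 k log k) with k = n * w + 1 and log the binary logarithm,
   using 2 ^ (2 k log k) = k ^ (2 k) to remain in nat. *)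
Definition state_bound (n w : nat) : nat :=
  2 ^ (1 + n ^ 2) * (n * w + 1) ^ (2 * (n * w + 1)).

(* Here N stands for |Q| * |delta|_B.  [maxn 1 u] is [u] unless u = 0; every
   constraint has size at least 1, whereas the expression with [u] itself is 0
   when u = 0 < e and 0 < N. *)
Definition B_bound (N e u : nat) : nat :=
  2 ^ N * ((N - 1)`! * (e + 1) ^ (N - 1) * (maxn 1 u) ^ (N ^ 2)) ^ e.

(* Main.v *)
Require Import Defs.
From mathcomp Require Import all_boot.
From mathcomp Require Import boolp zify.
Set Implicit Arguments.
Unset Strict Implicit.
Unset Printing Implicit Defensive.

(* A tree is accepted by A iff Eve has a winning strategy in a parity game on
   the pairs (node, state), and she then has a positional one.  The
   non-alternating automaton guesses such a strategy: it labels each edge of the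
   tree with the relation on Q formed by the moves of the strategy along this
   edge, and a deterministic parity automaton checks that all traces through
   these relations satisfy the parity condition.  That automaton is obtained by
   Safra's construction, with priorities in the manner of Piterman, from a Buchi
   automaton with |Q| * |omega| states that guesses a bad trace.  Several EU-pairs
   holding at one node are merged into one EU-pair on relations by deciding which
   children are singled out by more than one of them. *)

(** * Sequences *)

(** An execution tree may have several nodes with the same label that make different choices. A set
    of states merges them, so a trace through the guessed relations may mix their histories; it is
    sure to be a play of the strategy only when each choice depends on the node and the state alone.
    Hence the detour through signatures, which compare all occurrences of a position. Merging
    EU-pairs is delicate because a child singled out by two pairs counts once in the merged
    multiset. For positive [u], an atom can overlap [i] earlier ones in at most
    [(i * e + u ^ i) ^ e * u ^ (i * e)] ways; multiplying over [i] is the origin of the factorial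
    and of the exponent [N ^ 2]. In the bound on states, [k ^ (2 * k)] with [k = n * w + 1] comes
    from the two maps that code a Safra tree, each with [n * w] arguments and [k] values, together
    with a current priority. *)

Lemma liminf_exists (u : nat -> nat) M :
  (forall i, u i <= M) ->
  exists p i0, infinitely_often u p /\ forall i, i0 <= i -> p <= u i.
Proof.
move=> uM; pose ev p := exists i0, forall i, i0 <= i -> p <= u i.
have : exists2 p, ev p & ~ ev p.+1.
  apply: contrapT => none.
  have allp p : ev p.
    elim: p => [|p IH]; first by exists 0.
    by apply: contrapT => np; apply: none; exists p.
  have [i0 /(_ i0 (leqnn _))] := allp M.+1.
  by rewrite ltnNge uM.
case=> p [i0 hp] np; exists p, i0; split=> // i; apply: contrapT => nj.
apply: np; exists (maxn i i0) => j; rewrite geq_max => /andP [ij i0j].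
rewrite ltn_neqAle hp // andbT; apply/negP => /eqP e.
by apply: nj; exists j.
Qed.

Lemma infinitely_often_ge (u : nat -> nat) p i0 q :
  (forall i, i0 <= i -> p <= u i) -> infinitely_often u q -> p <= q.
Proof. by move=> h /(_ i0) [j ij <-]; exact: h. Qed.

(** A bounded sequence has a least recurrent value, so failure of the parity condition becomes
    positive data: an odd value that recurs and bounds a tail from below. *)
Lemma parity_even_notP (u : nat -> nat) M :
  (forall i, u i <= M) ->
  ~ parity_even u <->
  exists p i0, [/\ odd p, infinitely_often u p
                & forall i, i0 <= i -> p <= u i].
Proof.
move=> uM; split.
  have [p [i0 [io ge]]] := liminf_exists uM => npe.
  exists p, i0; split=> //; apply: contrapT => /negP op; apply: npe.
  by exists p; split=> // q; exact: infinitely_often_ge ge.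
move=> [p [i0 [op io ge]]] [q [ioq minq /negP]]; apply.
suff -> : q = p by [].
by apply/eqP; rewrite eqn_leq minq //= (infinitely_often_ge ge).
Qed.

Lemma nonincreasing_stabilizes (f : nat -> nat) i0 :
  (forall i, i0 <= i -> f i.+1 <= f i) ->
  exists2 i1, i0 <= i1 & forall i, i1 <= i -> f i = f i1.
Proof.
move=> dec.
suff H n i : i0 <= i -> f i <= n ->
    exists2 i1, i0 <= i1 & forall j, i1 <= j -> f j = f i1 by exact: H (leqnn _) (leqnn _).
have mono i1 : i0 <= i1 -> forall j, i1 <= j -> f j <= f i1.
  move=> h j /subnK <-; elim: (j - i1) => [|d IH] //.
  by rewrite addSn; apply: leq_trans IH; apply: dec; apply: leq_trans h (leq_addl _ _).
elim: n i => [|n IH] i ii fi.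
  exists i => // j ij; move: fi (mono _ ii _ ij).
  by rewrite leqn0 => /eqP ->; rewrite leqn0 => /eqP.
have [[j ij fj]|none] := EM (exists2 j, i <= j & f j <= n).
  exact: IH (leq_trans ii ij) fj.
exists i => // j ij; apply/eqP; rewrite eqn_leq mono //=.
apply: leq_trans fi _; rewrite ltnNge; apply/negP => h.
by apply: none; exists j.
Qed.

(** Once the bits below [d] are frozen, bit [d] can only switch on, so its negation is
    nonincreasing. *)
Lemma lex_stabilizes (b : nat -> nat -> bool) d i0 :
  (forall l, i0 <= l -> forall i, i < d ->
     (forall j, j < i -> b l.+1 j = b l j) -> b l i -> b l.+1 i) ->
  exists2 i1, i0 <= i1 & forall l, i1 <= l -> forall i, i < d -> b l i = b i1 i.
Proof.
elim: d => [|d IH] mono; first by exists i0.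
have [i1 h1 c1] := IH (fun l hl i hi => mono l hl i (ltnW hi)).
have [|i2 h2 c2] := @nonincreasing_stabilizes (fun l => ~~ b l d : nat) i1.
  move=> l hl; case e: (b l d) => /=; last by case: (b _ _).
  rewrite mono //; first exact: leq_trans h1 hl.
  by move=> j jd; rewrite !c1 // (leq_trans hl).
exists i2; first exact: leq_trans h1 h2.
move=> l hl i; rewrite ltnS leq_eqVlt => /predU1P [->|id].
  by have := c2 _ hl; case: (b l d); case: (b i2 d).
by rewrite !c1 // (leq_trans h2).
Qed.

Lemma infinitely_many_pigeonhole (S : finType) (P : nat -> Prop) (f : nat -> S) :
  (forall i, exists2 j, i <= j & P j) ->
  exists s, forall i, exists2 j, i <= j & P j /\ f j = s.
Proof.
move=> inf; apply: contrapT => none.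
have /choice [B hB] s : exists b, forall j, b <= j -> P j -> f j <> s.
  apply: contrapT => nb; apply: none; exists s => i; apply: contrapT => nj.
  by apply: nb; exists i => j ij Pj fj; apply: nj; exists j.
have [j hj Pj] := inf (\max_s B s).
by apply: (hB (f j) j _ Pj erefl); apply: leq_trans (leq_bigmax _) hj.
Qed.

(** Going backwards yields finite paths [c n] of every length. The pigeonhole principle gives nested
    infinite sets [A l] of lengths whose paths agree on the first [l] coordinates, and [s] is their
    limit. *)
Lemma koenig (S : finType) (X : nat -> {set S}) (R : nat -> S -> S -> Prop) :
  (forall l, X l != set0) ->
  (forall l t, t \in X l.+1 -> exists2 s, s \in X l & R l s t) ->
  exists s : nat -> S, (forall l, s l \in X l) /\ forall l, R l (s l) (s l.+1).
Proof.
move=> X0 back.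
have chain n t : t \in X n -> exists s : nat -> S, [/\ s n = t,
    forall l, l <= n -> s l \in X l & forall l, l < n -> R l (s l) (s l.+1)].
  elim: n t => [|n IH] t tX.
    by exists (fun=> t); split=> // l; rewrite leqn0 => /eqP ->.
  have [s sX st] := back _ _ tX; have [c [cn cX cR]] := IH _ sX.
  exists (fun l => if l <= n then c l else t); split; first by rewrite ltnn.
    move=> l; case: (leqP l n) => [ln _|]; first exact: cX.
    by move=> ln ln'; have -> : l = n.+1 by apply/eqP; rewrite eqn_leq ln' ln.
  move=> l; case: (ltngtP l n) => [ln _|nl|-> _]; [exact: cR | | by rewrite cn].
  by rewrite ltnS leqNgt nl.
have /choice [c hc] n : exists c : nat -> S,
    (forall l, l <= n -> c l \in X l) /\ forall l, l < n -> R l (c l) (c l.+1).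
  have /set0Pn [t /chain [c [_ c1 c2]]] := X0 n.
  by exists c.
pose inf (P : nat -> Prop) := forall i, exists2 j, i <= j & P j.
have step (A : {P : nat -> Prop | inf P}) (l : nat) :
    exists s, inf (fun j => sval A j /\ c j l = s).
  exact: infinitely_many_pigeonhole (svalP A).
have infT : inf (fun=> True) by move=> i; exists i.
pose nxt A l : {P : nat -> Prop | inf P} := 
    exist inf _ (projT2 (cid (step A l))).
pose A := nat_rect (fun=> {P : nat -> Prop | inf P}) (exist inf _ infT)
            (fun l B => nxt B l).
pose s l := projT1 (cid (step (A l) l)).
have As l j : sval (A l.+1) j -> sval (A l) j /\ c j l = s l by [].
exists s; split=> l.
  have [j lj /As [_ <-]] := svalP (A l.+1) l.
  by have [h _] := hc j; exact: h.
(* A path whose length lies in [A l.+2] agrees with [s] at both [l] and [l.+1]. *)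
have [j lj /As [/As [_ <-] <-]] := svalP (A l.+2) l.+1.
by have [_ h] := hc j; exact: h.
Qed.

(** * Safra steps *)

Section Safra.
Variable S : finType.
Implicit Types (L : seq {set S}) (X I F : {set S}) (E : rel S) (s t : S).

Notation lab L i := (nth set0 L i).

(* A Safra tree is given by the labels of its nodes in order of age; as the
   labels are laminar, the tree order is inclusion and need not be stored. *)
Definition laminar L : Prop := forall i j, i < j ->
  forall s, s \in lab L i -> s \in lab L j -> lab L j \subset lab L i.

(* Membership bits of the element of X that is lexicographically greatest for L:
   moving each state along such a predecessor is Safra's rule that a state stays
   in the oldest of the siblings that contain it. *)
Fixpoint greedy L X : seq bool :=
  if L is B :: L' then
    let b := X :&: B != set0 in b :: greedy L' (if b then X :&: B else X)
  else [::].

Definition preds E L t : {set S} := [set s in lab L 0 | E s t].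

Definition move_labels E L : seq {set S} :=
  mkseq (fun i => [set t | nth false (greedy L (preds E L t)) i]) (size L).

(** One singleton for each accepting state, whichever labels contain it: laminarity is then
    immediate, and [collapse] restores the bound on the number of labels. *)
Definition births F L : seq {set S} := [seq [set t] | t <- enum (F :&: lab L 0)].

Definition grow E F L : seq {set S} :=
  move_labels E L ++ births F (move_labels E L).

(** In a laminar family the younger labels that meet label [i] lie inside it, so this is Safra's
    vertical merge: the label is the union of its descendants, which [kept] then deletes. *)
Definition green L i : bool :=
  (lab L i != set0) && [forall s in lab L i, has (fun B : {set S} => s \in B) (drop i.+1 L)].

Definition kept L j : bool :=
  (lab L j != set0) &&
  all (fun i => ~~ (green L i && (lab L j \subset lab L i))) (iota 0 j).

Definition collapse L : seq {set S} :=
  [seq lab L j | j <- iota 0 (size L) & kept L j].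

(** Without an event [find] returns [size L], so a step with no flash falls into the even case of
    [rank_priority]. *)
Definition first_dead L : nat := find (predC (kept L)) (iota 0 (size L)).
Definition first_green L : nat := find (green L) (iota 0 (size L)).

(* Flashes get the odd priorities and deaths the even ones, because the word
   automaton is to accept what the Buchi automaton rejects. *)
Definition rank_priority L : nat :=
  if first_green L < first_dead L then (first_green L).*2.+1
  else (minn (first_dead L) #|S|).*2.

Lemma lab_default L i : size L <= i -> lab L i = set0.
Proof. exact: nth_default. Qed.

Lemma lab_size L i s : s \in lab L i -> i < size L.
Proof. by case: ltnP => // h; rewrite lab_default // inE. Qed.

(** The set is narrowed at each label and never becomes empty, so all the bits belong to a single
    element. A successor thus inherits every membership from one predecessor. *)
Lemma greedy_best L X : X != set0 ->
  exists2 s, s \in X & forall i, nth false (greedy L X) i = (s \in lab L i).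
Proof.
elim: L X => [|B L IH] X X0.
  by case/set0Pn: X0 => s sX; exists s => // i; rewrite !nth_nil inE.
have [s sX hs] : exists2 s, s \in (if X :&: B != set0 then X :&: B else X)
    & forall i, nth false (greedy L (if X :&: B != set0 then X :&: B else X)) i = (s \in lab L i).
  by apply: IH; case: ifP.
exists s; first by move: sX; case: ifP => // _; rewrite inE => /andP [].
case=> [|i] /=; last exact: hs.
case: ifPn sX => [_|]; first by rewrite inE => /andP [_ ->].
rewrite negbK => /eqP e sX; apply/esym/negP => sB.
by have := in_set0 s; rewrite -e inE sX sB.
Qed.

Lemma greedy_lex L X s i : s \in X ->
  (forall j, j < i -> nth false (greedy L X) j = (s \in lab L j)) ->
  s \in lab L i -> nth false (greedy L X) i.
Proof.
elim: L X i => [|B L IH] X [|i] sX agree /=; rewrite ?nth_nil ?inE //.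
  by move=> sB; apply/set0Pn; exists s; rewrite inE sX.
apply: IH => [|j ji]; last exact: (agree j.+1).
have /= := agree 0 isT; case: ifP => // _ /esym sB.
by rewrite inE sX.
Qed.

Lemma greedy_set0 L i : nth false (greedy L set0) i = false.
Proof.
elim: L i => [|B L IH] [|i] //=; first by rewrite set0I eqxx.
by rewrite set0I eqxx IH.
Qed.

Lemma size_move E L : size (move_labels E L) = size L.
Proof. exact: size_mkseq. Qed.

Lemma move_labelE E L t i : i < size L ->
  (t \in lab (move_labels E L) i) = nth false (greedy L (preds E L t)) i.
Proof. by move=> h; rewrite nth_mkseq // inE. Qed.

Lemma move_best E L t i : t \in lab (move_labels E L) i ->
  exists s, [/\ s \in lab L 0, E s t &
    forall j, (t \in lab (move_labels E L) j) = (s \in lab L j)].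
Proof.
move=> tL; have iL : i < size L by rewrite -(size_move E) (lab_size tL).
have /(greedy_best L) [s] : preds E L t != set0.
  by apply: contraTneq tL => e; rewrite move_labelE // e greedy_set0.
rewrite inE => /andP [s0 st] hs; exists s; split=> // j.
have [jL|jL] := ltnP j (size L); first by rewrite move_labelE.
by rewrite !lab_default ?size_move // !inE.
Qed.

Lemma move_lex E L s t i : s \in lab L 0 -> E s t ->
  (forall j, j < i -> (t \in lab (move_labels E L) j) = (s \in lab L j)) ->
  s \in lab L i -> t \in lab (move_labels E L) i.
Proof.
move=> s0 st agree sL; have iL := lab_size sL; rewrite move_labelE //.
apply: greedy_lex sL => [|j ji]; first by rewrite inE s0.
by rewrite -move_labelE ?agree // (ltn_trans ji).
Qed.

(** Since the memberships of a state are copied from one predecessor, a failure of inclusion would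
    already show among the predecessors. *)
Lemma move_laminar E L : laminar L -> laminar (move_labels E L).
Proof.
move=> lamL i j ij t ti tj; apply/subsetP => t' t'j.
have [s [_ _ hs]] := move_best ti; have [s' [_ _ hs']] := move_best t'j.
rewrite hs'; move: t'j; rewrite hs'; apply/subsetP.
by apply: (lamL _ _ ij s); rewrite -hs.
Qed.

Lemma births_label F L i t :
  t \in lab (births F L) i -> [/\ t \in F, t \in lab L 0 & lab (births F L) i = [set t]].
Proof.
move=> ti; have := lab_size ti; rewrite size_map => h.
move: ti; rewrite /births (nth_map t) // inE => /eqP e.
have : t \in enum (F :&: lab L 0) by rewrite e mem_nth.
by rewrite mem_enum inE -e => /andP [].
Qed.

Lemma grow_old E F L i : i < size L -> lab (grow E F L) i = lab (move_labels E L) i.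
Proof. by move=> h; rewrite nth_cat size_move h. Qed.

Lemma grow_new E F L i t : size L <= i -> t \in lab (grow E F L) i ->
  [/\ t \in F, t \in lab (move_labels E L) 0 & lab (grow E F L) i = [set t]].
Proof. by move=> h; rewrite nth_cat size_move ltnNge h /=; exact: births_label. Qed.

Lemma grow_born E F L t : t \in F -> t \in lab (move_labels E L) 0 ->
  exists2 i, size L <= i & t \in lab (grow E F L) i.
Proof.
move=> tF t0; pose l := enum (F :&: lab (move_labels E L) 0).
have tl : t \in l by rewrite mem_enum inE tF.
exists (size L + index t l); first exact: leq_addr.
rewrite nth_cat size_move ltnNge leq_addr /= addKn /births.
by rewrite (nth_map t) ?index_mem // nth_index // set11.
Qed.

Lemma grow_laminar E F L : laminar L -> laminar (grow E F L).
Proof.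
move=> lamL i j ij t ti tj; have [jL|Lj] := ltnP j (size L).
  move: ti tj; rewrite !grow_old // ?(ltn_trans ij) //.
  exact: move_laminar.
by have [_ _ ->] := grow_new Lj tj; rewrite sub1set.
Qed.

Lemma greenP L i s : green L i -> s \in lab L i ->
  exists2 j, i < j & s \in lab L j.
Proof.
case/andP=> _ /forall_inP h /h /(has_nthP set0) [j _]; rewrite nth_drop => sj.
by exists (i.+1 + j) => //; rewrite ltnS leq_addr.
Qed.

Lemma nongreen_own L i : lab L i != set0 -> ~~ green L i ->
  exists2 s, s \in lab L i & forall j, i < j -> s \notin lab L j.
Proof.
rewrite /green => -> /forall_inPn [s si hs]; exists s => // j ij.
apply: contra hs => sj; apply/(has_nthP set0); exists (j - i.+1).
  by rewrite size_drop; have := lab_size sj; lia.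
by rewrite nth_drop subnKC.
Qed.

Lemma keptP L j : reflect (lab L j != set0 /\
    forall i, i < j -> green L i -> ~~ (lab L j \subset lab L i)) (kept L j).
Proof.
apply: (iffP andP) => -[h1 h2]; split=> //.
  by move=> i ij gi; have /allP /(_ i) := h2; rewrite mem_iota ij gi; exact.
apply/allP => i; rewrite mem_iota /= => /h2 h; apply/nandP.
by case: (boolP (green L i)) => [/h|]; [right|left].
Qed.

Lemma kept_size L j : kept L j -> j < size L.
Proof. by case/keptP=> /set0Pn [s /lab_size]. Qed.

Definition new_rank L j := count (kept L) (iota 0 j).

Lemma lab_collapse L j : kept L j ->
  new_rank L j < size (collapse L) /\ lab (collapse L) (new_rank L j) = lab L j.
Proof.
move=> kj; have jL := kept_size kj.
rewrite /collapse /new_rank -(subnKC (ltnW jL)) iotaD filter_cat map_cat.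
have -> : iota (0 + j) (size L - j) = j :: iota j.+1 (size L - j.+1).
  by rewrite -(subnSK jL) add0n.
rewrite /= kj /=; have <- := size_filter (kept L) (iota 0 j).
split; first by rewrite size_cat /= !size_map addnS ltnS leq_addr.
by rewrite nth_cat size_map ltnn subnn.
Qed.

Lemma collapse_lab L i : i < size (collapse L) ->
  exists2 j, kept L j & new_rank L j = i.
Proof.
rewrite /collapse size_map => h.
set l := [seq j <- _ | _] in h; pose j := nth 0 l i.
have jl : j \in l by exact: mem_nth.
have := jl; rewrite mem_filter => /andP [kj _]; exists j => //.
have [h1 _] := lab_collapse kj.
have ul : uniq l by rewrite filter_uniq ?iota_uniq.
have jL := kept_size kj.
apply/eqP; rewrite -(nth_uniq 0 _ h ul); last by move: h1; rewrite /collapse size_map.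
rewrite -/j; apply/eqP; rewrite /l /new_rank -[in LHS](subnKC (ltnW jL)) iotaD filter_cat.
have -> : iota (0 + j) (size L - j) = j :: iota j.+1 (size L - j.+1).
  by rewrite -(subnSK jL) add0n.
by rewrite /= kj nth_cat size_filter ltnn subnn.
Qed.

Lemma new_rank_le L j : new_rank L j <= j.
Proof. by rewrite -[leqRHS](size_iota 0) count_size. Qed.

Lemma new_rankD L i j : i <= j ->
  new_rank L j = new_rank L i + count (kept L) (iota i (j - i)).
Proof. by move=> h; rewrite /new_rank -(subnKC h) iotaD count_cat addKn. Qed.

Lemma before_dead L i : i < first_dead L -> kept L i.
Proof.
move=> h; have := before_find 0 h; rewrite nth_iota /=; first by move/negbFE.
by apply: leq_trans h _; rewrite -[leqRHS](size_iota 0) find_size.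
Qed.

Lemma first_dead_size L : first_dead L <= size L.
Proof. by rewrite -[leqRHS](size_iota 0) find_size. Qed.

Lemma first_greenP L : first_green L < size L -> green L (first_green L).
Proof.
move=> h; have hs : has (green L) (iota 0 (size L)) by rewrite has_find size_iota.
by have := nth_find 0 hs; rewrite nth_iota.
Qed.

Lemma before_green L i : i < first_green L -> ~~ green L i.
Proof.
move=> h; apply/negP => gi; have := before_find 0 h.
have iL : i < size L by case/andP: gi => /set0Pn [s /lab_size].
by rewrite nth_iota // add0n gi.
Qed.

Lemma first_dead_max L j : (forall i, i < j -> kept L i) -> j <= first_dead L.
Proof.
move=> h; rewrite leqNgt; apply/negP => lt; have := h _ lt.
have jL : j <= size L.
  by case: j h {lt} => // j h; exact/kept_size/h.
have hs : has (predC (kept L)) (iota 0 (size L)).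
  by rewrite has_find size_iota (leq_trans lt).
have := nth_find 0 hs; rewrite -/(first_dead L) nth_iota ?(leq_trans lt) //=.
by move/negbTE ->.
Qed.

Lemma new_rank_id L j : j <= first_dead L -> new_rank L j = j.
Proof.
move=> h; apply/eqP; rewrite -[X in _ == X](size_iota 0) -all_count.
by apply/allP => i; rewrite mem_iota => /= ij; apply: before_dead; exact: leq_trans ij h.
Qed.

Lemma new_rank_lt L j : first_dead L < j -> kept L j -> new_rank L j < j.
Proof.
move=> h kj; rewrite ltn_neqAle new_rank_le andbT; apply/negP => /eqP e.
have : j <= first_dead L.
  apply: first_dead_max => i ij.
  move/eqP: e; rewrite -[X in _ == X](size_iota 0) -all_count => /allP; apply.
  by rewrite mem_iota.
by rewrite leqNgt h.
Qed.

Lemma new_rank_ge L d j : d <= first_dead L -> d <= j -> d <= new_rank L j.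
Proof. by move=> hd dj; rewrite (new_rankD _ dj) new_rank_id // leq_addr. Qed.

Lemma collapse_old L i : i < first_dead L ->
  i < size (collapse L) /\ lab (collapse L) i = lab L i.
Proof.
by move=> h; have := lab_collapse (before_dead h); rewrite new_rank_id // ltnW.
Qed.

Lemma new_rank_homo L i j : kept L i -> i < j -> new_rank L i < new_rank L j.
Proof.
move=> ki ij; rewrite (new_rankD _ (ltnW ij)) -(subnSK ij) /= ki; lia.
Qed.

Lemma collapse_laminar L : laminar L -> laminar (collapse L).
Proof.
move=> lamL i j ij s si sj.
have [i' ki' ei] := collapse_lab (lab_size si).
have [j' kj' ej] := collapse_lab (lab_size sj).
move: si sj; rewrite -ei -ej (lab_collapse ki').2 (lab_collapse kj').2.
apply: lamL; rewrite ltnNge leq_eqVlt; apply/negP => /predU1P [e|lt].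
  by move: ij; rewrite -ei -ej e ltnn.
by move: ij; rewrite -ei -ej ltnNge (ltnW (new_rank_homo kj' lt)).
Qed.

Lemma collapse_own L i : laminar L -> i < size (collapse L) ->
  exists2 s, s \in lab (collapse L) i
           & forall j, i < j -> s \notin lab (collapse L) j.
Proof.
move=> lamL iC; have [i' ki' ei] := collapse_lab iC.
have [li' _] := keptP _ _ ki'.
(* A green label loses all its descendants, so any of its elements will do; a non-green one has an
   element outside all younger labels. *)
have [s si hs] : exists2 s, s \in lab L i' &
    forall j, i' < j -> kept L j -> s \notin lab L j.
  have [gi|gi] := boolP (green L i'); last first.
    by have [s si hs] := nongreen_own li' gi; exists s => // j /hs.
  case/set0Pn: li' => s si; exists s => // j ij /keptP [_ /(_ _ ij gi)].
  by apply: contra => sj; exact: lamL sj.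
exists s; first by rewrite -ei (lab_collapse ki').2.
move=> j ij; apply/negP => sj; have [j' kj' ej] := collapse_lab (lab_size sj).
move: sj; rewrite -ej (lab_collapse kj').2; apply/negP; apply: hs => //.
rewrite ltnNge leq_eqVlt; apply/negP => /predU1P [e|lt].
  by move: ij; rewrite -ei -ej e ltnn.
by move: ij; rewrite -ei -ej ltnNge (ltnW (new_rank_homo kj' lt)).
Qed.

(** Sending each label to an element whose youngest label it is gives an injection into [S]. *)
Lemma size_collapse L : laminar L -> size (collapse L) <= #|S|.
Proof.
move=> lamL; case: (posnP (size (collapse L))) => [->//|pos].
have [s0 _ _] := collapse_own lamL pos.
have /choice [own hown] i : exists s, i < size (collapse L) ->
    s \in lab (collapse L) i /\ forall j, i < j -> s \notin lab (collapse L) j.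
  case: (ltnP i (size (collapse L))) => [|_]; last by exists s0.
  by case/(collapse_own lamL) => s h1 h2; exists s.
rewrite -(card_ord (size _)) -(card_in_imset (f := fun i : 'I_(size (collapse L)) => own i)).
  exact: max_card.
move=> i j _ _ e; apply/val_inj; case: (ltngtP i j) => // lt.
  by have [_ /(_ _ lt)] := hown _ (ltn_ord i); rewrite e (hown _ (ltn_ord j)).1.
by have [_ /(_ _ lt)] := hown _ (ltn_ord j); rewrite -e (hown _ (ltn_ord i)).1.
Qed.

End Safra.

(** * Safra runs *)

Section SafraRun.
Variables (S : finType) (I F : {set S}) (E : nat -> rel S).
Hypothesis I_neq0 : I != set0.

Notation lab L i := (nth set0 L i).

Fixpoint safra_run n : seq {set S} :=
  if n is n'.+1 then collapse (grow (E n') F (safra_run n')) else [:: I].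

Definition safra_priority n : nat :=
  if n is n'.+1 then rank_priority (grow (E n') F (safra_run n')) else 0.

Notation G n := (grow (E n) F (safra_run n)).

Lemma safra_laminar n : laminar (safra_run n).
Proof.
elim: n => [|n IH]; last exact/collapse_laminar/grow_laminar.
by move=> i [|j] // ij s _; rewrite /= nth_nil inE.
Qed.

Lemma size_safra n : size (safra_run n) <= #|S|.
Proof.
case: n => [|n]; last exact/size_collapse/grow_laminar/safra_laminar.
by have /set0Pn [s _] := I_neq0; apply/card_gt0P; exists s.
Qed.

Lemma safra_priority_le n : safra_priority n <= #|S|.*2.
Proof.
case: n => //= n; rewrite /rank_priority; case: ltnP => h.
  have [h1 _] := collapse_old h.
  apply: (@leq_trans (first_green (G n)).+1.*2) => //.
  by rewrite leq_double (leq_trans h1) ?(size_safra n.+1).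
by rewrite leq_double geq_minr.
Qed.

Lemma safra_label_old n i : i < first_dead (G n) ->
  i < size (safra_run n.+1) /\ lab (safra_run n.+1) i = lab (G n) i.
Proof. exact: collapse_old. Qed.

Lemma safra_rooted n i s : s \in lab (safra_run n) i -> s \in lab (safra_run n) 0.
Proof.
elim: n i s => [|n IH] i s; first by case: i => //= i; rewrite nth_nil inE.
move=> si; have [j kj ej] := collapse_lab (lab_size si).
move: si; rewrite -ej (lab_collapse kj).2 => sj.
have s0 : s \in lab (move_labels (E n) (safra_run n)) 0.
  have [jL|Lj] := ltnP j (size (safra_run n)); last by have [] := grow_new Lj sj.
  move: sj; rewrite grow_old // => /move_best [t [t0 _ ht]].
  by rewrite ht.
have sG : s \in lab (G n) 0.
  by rewrite grow_old //; have := lab_size s0; rewrite size_move.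
have k0 : kept (G n) 0 by apply/keptP; split=> //; apply/set0Pn; exists s.
by have := lab_collapse k0; rewrite new_rank_id // => -[_ ->].
Qed.

Lemma safra_pred n i s : s \in lab (safra_run n.+1) i ->
  exists t, [/\ t \in lab (safra_run n) 0, E n t s &
    forall j, (s \in lab (move_labels (E n) (safra_run n)) j) = (t \in lab (safra_run n) j)].
Proof.
move=> si; have [j kj ej] := collapse_lab (lab_size si).
move: si; rewrite -ej (lab_collapse kj).2 => sj.
have [jL|Lj] := ltnP j (size (safra_run n)).
  by move: sj; rewrite grow_old // => /move_best.
by have [_ /move_best] := grow_new Lj sj.
Qed.

Lemma safra_reach n s : s \in lab (safra_run n) 0 ->
  exists c : nat -> S, [/\ c 0 \in I, c n = s & forall j, j < n -> E j (c j) (c j.+1)].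
Proof.
elim: n s => [|n IH] s; first by exists (fun=> s).
case/safra_pred=> t [/IH [c [c0 cn cE]] st _].
exists (fun j => if j <= n then c j else s); split=> //; first by rewrite ltnn.
move=> j; case: (ltngtP j n) => [jn _|nj|-> _]; [exact: cE | | by rewrite cn].
by rewrite ltnS leqNgt nj.
Qed.

(** Outside [F] no singleton is born, so labels around the run can only be inherited. *)
Lemma safra_run_grow n s t i :
  (forall j, (t \in lab (move_labels (E n) (safra_run n)) j) = (s \in lab (safra_run n) j)) ->
  t \notin F -> t \in lab (G n) i -> s \in lab (safra_run n) i.
Proof.
move=> h tF ti; have [iL|Li] := ltnP i (size (safra_run n)).
  by move: ti; rewrite grow_old // h.
by have [tF'] := grow_new Li ti; rewrite tF' in tF.
Qed.

(** Rank [g] finally survives forever and flashes infinitely often. König's lemma yields a run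
    inside its label, completed at the start by [safra_reach]. A flash strips the run of the labels
    younger than [g], and only a visit to [F] can give it one again before the next flash. *)
Lemma safra_sound p i0 : odd p -> infinitely_often safra_priority p ->
  (forall i, i0 <= i -> p <= safra_priority i) ->
  exists s : nat -> S, [/\ s 0 \in I, forall j, E j (s j) (s j.+1)
                         & forall i, exists2 j, i <= j & s j \in F].
Proof.
move=> op io ge.
have [g ep] : exists g, p = g.*2.+1.
  by exists p./2; rewrite -[LHS]odd_double_half op.
have alive n : i0 <= n -> g < first_dead (G n).
  move=> hn; have /= := ge n.+1 (leq_trans hn (leqnSn _)).
  rewrite ep /rank_priority.
  case: (ltnP (first_green _)) => h; lia.
have flash i : exists n, [/\ i <= n, i0 <= n & green (G n) g].
  have [[|n]] := io (maxn i i0).+1; first by rewrite ltn0.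
  rewrite ltnS geq_max => /andP [h1 h2] /=; rewrite ep /rank_priority; case: ifP; last by lia.
  move=> lt e; have {}e : first_green (G n) = g by lia.
  by exists n; split=> //; rewrite -e first_greenP // (leq_trans lt) ?first_dead_size.
(* The priority at [n.+1] is computed from [G n], hence the shift by one. *)
pose n1 := i0.+1.
have inG n : n1 <= n -> g < size (safra_run n) /\ lab (safra_run n) g = lab (G n.-1) g.
  by case: n => // n hn; apply: safra_label_old; apply: alive.
have [l|l t|s [sX sR]] := @koenig _ (fun l => lab (safra_run (n1 + l)) g)
   (fun l s t => E (n1 + l) s t /\
      forall j, (t \in lab (move_labels (E (n1 + l)) (safra_run (n1 + l))) j)
              = (s \in lab (safra_run (n1 + l)) j)).
- rewrite (inG _ (leq_addr _ _)).2.
  have /alive/before_dead/keptP [] // : i0 <= (n1 + l).-1 by rewrite /n1 addSn leq_addr.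
- rewrite addnS => ti; have [s [s0 st h]] := safra_pred ti; exists s => //.
  have [gL _] := inG _ (leq_addr l n1).
  have [_] := inG (n1 + l).+1 (leq_trans (leq_addr l n1) (leqnSn _)).
  by rewrite /= -h => e; move: ti; rewrite e grow_old.
have [c [c0 cn cE]] := safra_reach (safra_rooted (sX 0)); rewrite addn0 in cn cE.
pose r j := if j < n1 then c j else s (j - n1).
have rs l : r (n1 + l) = s l by rewrite /r ltnNge leq_addr addKn.
exists r; split=> [|j|i]; first by [].
  have [jn|nj] := ltnP j n1; last first.
    by rewrite -(subnKC nj) -addnS !rs; exact: (sR _).1.
  rewrite /r jn; case: ltnP => [_|nj]; first exact: cE.
  have ej : j.+1 = n1 by apply/eqP; rewrite eqn_leq jn nj.
  by rewrite ej subnn -cn -ej; apply: cE; rewrite ej.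
apply: contrapT => none.
have notF j : i <= j -> r j \notin F.
  by move=> ij; apply/negP => rj; apply: none; exists j.
have rX n : n1 <= n -> r n \in lab (safra_run n) g.
  by move=> h; rewrite -(subnKC h) rs; exact: sX.
have rR n : n1 <= n -> forall j,
    (r n.+1 \in lab (move_labels (E n) (safra_run n)) j) = (r n \in lab (safra_run n) j).
  by move=> h; rewrite -(subnKC h) -addnS !rs; exact: (sR _).2.
have [n2 [in2 _ g2]] := flash (maxn i n1); move: in2; rewrite geq_max => /andP [in2 n12].
have own n : n2 < n -> forall k, g < k -> r n \notin lab (safra_run n) k.
  elim: n => // n IH; rewrite ltnS => nn k gk; apply/negP => rk.
  have i0n : i0 <= n by apply: leq_trans nn; apply: leq_trans n12; exact: leqnSn.
  have [j kj ej] := collapse_lab (lab_size rk).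
  have gj : g < j.
    rewrite ltnNge; apply/negP => jg; move: gk; rewrite -ej ltnNge.
    by rewrite (leq_trans (new_rank_le _ _)).
  move: rk; rewrite -ej (lab_collapse kj).2 => rj.
  have n1n := leq_trans n12 nn.
  move: nn; rewrite leq_eqVlt => /predU1P [e|nn]; last first.
    move: (IH nn j gj) => /negP; apply.
    by apply: safra_run_grow (rR _ n1n) _ rj => //; apply: notF; apply: leq_trans in2 _; lia.
  subst n2; have /keptP [_ /(_ _ gj g2) /negP] := kj; apply.
  apply: (@grow_laminar _ (E n) F _ (@safra_laminar n) _ _ gj (r n.+1)) => //.
  have := rX n.+1 (leq_trans n1n (leqnSn _)).
  by rewrite (inG _ (leq_trans n1n (leqnSn _))).2.
(* At this later flash every state of label [g] must lie in a younger label, which [own] excludes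
   for the run. *)
have [n3 [n23 _ g3]] := flash n2.+1.
have n13 : n1 <= n3 by lia.
have := rX n3.+1 (leq_trans n13 (leqnSn _)).
rewrite (inG _ (leq_trans n13 (leqnSn _))).2 /= => rg.
have [j gj rj] := greenP g3 rg.
have /negP := own _ n23 _ gj; apply.
by apply: safra_run_grow (rR _ n13) _ rj => //; apply: notF; lia.
Qed.

(* The bits of the run below the least recurrent rank d grow lexicographically,
   hence stabilize; from then on the least rank >= d containing the run can only
   decrease, and strictly so whenever a smaller rank dies. *)
Lemma safra_complete (s : nat -> S) d i0 :
  s 0 \in I -> (forall j, E j (s j) (s j.+1)) ->
  (forall i, exists2 j, i <= j & s j \in F) ->
  infinitely_often safra_priority d.*2 ->
  ~ (forall i, i0 <= i -> d.*2 <= safra_priority i).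
Proof.
move=> s0 sE sF io ge.
have dG n : i0 <= n -> d <= first_dead (G n) /\ forall i, i < d -> ~~ green (G n) i.
  move=> hn; have /= := ge n.+1 (leq_trans hn (leqnSn _)); rewrite /rank_priority => h.
  have [h1 h2] : d <= first_dead (G n) /\ d <= first_green (G n).
    by move: h; case: ltnP; lia.
  by split=> // i id; apply: before_green; exact: leq_trans id h2.
have root n : s n \in lab (safra_run n) 0.
  elim: n => // n IH.
  have s1 : s n.+1 \in lab (G n) 0.
    by rewrite grow_old ?(lab_size IH) //; exact: (move_lex IH (sE n) _ IH).
  have k0 : kept (G n) 0 by apply/keptP; split=> //; apply/set0Pn; exists (s n.+1).
  by have := lab_collapse k0; rewrite new_rank_id // => -[_ ->].
have size_d n : i0 < n -> d <= size (safra_run n).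
  case: n => // n hn; have [h _] := dG n hn.
  case: (posnP d) => [->//|dp]; have [|lt _] := @safra_label_old n d.-1.
    by rewrite prednK.
  by rewrite -(prednK dp).
have [|i1 h1 const] := @lex_stabilizes (fun n i => s n \in lab (safra_run n) i) d i0.
  move=> n hn i id agree si; have [hd _] := dG n hn.
  rewrite (safra_label_old (leq_trans id hd)).2 grow_old ?(lab_size si) //.
  apply: (move_lex (root n) (sE n) _ si) => j ji; rewrite -agree //.
  rewrite (safra_label_old (leq_trans (ltn_trans ji id) hd)).2 grow_old //.
  by rewrite (ltn_trans ji) ?(lab_size si).
(* The least label of rank at least [d] around the run survives the collapse: a green label
   swallowing it would be older, hence by minimality of rank below [d], where nothing flashes. *)
have step n j : i1 <= n -> d <= j -> s n.+1 \in lab (G n) j ->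
    exists f, [/\ d <= f, f <= j, s n.+1 \in lab (safra_run n.+1) f
                & first_dead (G n) <= j -> f < j].
  move=> hn dj sj; have [hd ng] := dG n (leq_trans h1 hn).
  have ex : exists j, (d <= j) && (s n.+1 \in lab (G n) j) by exists j; rewrite dj.
  case: (ex_minnP ex) => k /andP [dk sk] mink.
  have kj : k <= j by apply: mink; rewrite dj.
  have kk : kept (G n) k.
    apply/keptP; split=> [|i ik gi]; first by apply/set0Pn; exists (s n.+1).
    apply/negP => /subsetP /(_ _ sk) si.
    have di : d <= i by rewrite leqNgt; apply/negP => /ng; rewrite gi.
    by have := mink i; rewrite di si leqNgt ik => /(_ isT).
  exists (new_rank (G n) k); split.
  - exact: new_rank_ge.
  - exact: leq_trans (new_rank_le _ _) kj.
  - by rewrite (lab_collapse kk).2.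
  move: kj; rewrite leq_eqVlt => /predU1P [<- | kj _]; last first.
    exact: leq_ltn_trans (new_rank_le _ _) kj.
  rewrite leq_eqVlt => /predU1P [e|lt]; last exact: new_rank_lt.
  have : k < first_dead (G n).
    apply: first_dead_max => i; rewrite ltnS leq_eqVlt => /predU1P [->//|].
    by rewrite -e; exact: before_dead.
  by rewrite e ltnn.
(* A visit to [F] puts the run into a newborn label, whose rank is at least the number of old labels
   and so at least [d]. The descent starts there. *)
have [[|n2] hn2 F2] := sF i1.+2; first by rewrite ltn0 in hn2.
(* If the run entered no label of rank between [d] and [j], its bits below [j] would be unchanged,
   by stability below [d] and minimality of [j]; then [move_lex] would keep it in label [j]. *)
have step2 n j : i1 <= n -> d <= j -> s n \in lab (safra_run n) j ->
   (forall i, d <= i -> i < j -> s n \notin lab (safra_run n) i) ->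
   exists k, [/\ d <= k, k <= j & s n.+1 \in lab (G n) k].
  move=> hn dj sj minj; apply: contrapT => none.
  have nG k : d <= k -> k <= j -> s n.+1 \notin lab (G n) k.
    by move=> dk kj; apply/negP => sk; apply: none; exists k.
  have /negP := nG j dj (leqnn _); apply.
  have jL := lab_size sj; rewrite grow_old //.
  apply: (move_lex (root n) (sE n) _ sj) => i ij; rewrite -(grow_old (E n) F) ?(ltn_trans ij) //.
  have [hd _] := dG n (leq_trans h1 hn).
  have [id|di] := ltnP i d.
    rewrite -(safra_label_old (leq_trans id hd)).2.
    by rewrite (const n) // (const n.+1) // (leq_trans hn).
  by rewrite (negbTE (minj _ di ij)) (negbTE (nG _ di (ltnW ij))).
have /choice [f hf] n : exists f, i1 <= n -> n2 < n -> [/\ d <= f, s n \in lab (safra_run n) f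
    & forall i, d <= i -> i < f -> s n \notin lab (safra_run n) i].
  have [/andP [hn n2n]|no] := boolP ((i1 <= n) && (n2 < n)); last first.
    by exists 0 => h1' h2'; rewrite h1' h2' in no.
  have ex : exists j, (d <= j) && (s n \in lab (safra_run n) j).
    elim: n hn n2n => // n IH hn; rewrite ltnS leq_eqVlt => /predU1P [e|n2n].
      subst n2; have := grow_born F2 (_ : s n.+1 \in lab (move_labels (E n) (safra_run n)) 0).
      have : s n.+1 \in lab (move_labels (E n) (safra_run n)) 0.
        exact: (move_lex (root n) (sE n) _ (root n)).
      move=> h /(_ h) [j jL sj].
      have i1n : i1 <= n by lia.
      have [|f [df _ sf _]] := step n j i1n _ sj; last by exists f; rewrite df.
      by apply: leq_trans (size_d n _) jL; lia.
    have i1n : i1 <= n by lia.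
    case: (ex_minnP (IH i1n n2n)) => j /andP [dj sj] minj.
    have [|k [dk _ sk]] := step2 n j i1n dj sj.
      by move=> i di ij; apply/negP => si; have := minj i; rewrite di si leqNgt ij => /(_ isT).
    by have [f [df _ sf _]] := step n k i1n dk sk; exists f; rewrite df.
  case: (ex_minnP ex) => j /andP [dj sj] minj; exists j => _ _; split=> // i di ij.
  by apply/negP => si; have := minj i; rewrite di si leqNgt ij => /(_ isT).
pose n3 := maxn i1 n2.+1.
have fstep n : n3 <= n -> f n.+1 <= f n /\ (first_dead (G n) <= f n -> f n.+1 < f n).
  rewrite geq_max => /andP [hn n2n].
  have [dj sj minj] := hf n hn n2n.
  have [k [dk kj sk]] := step2 n _ hn dj sj minj.
  have [h [dh hk sh lt]] := step n k hn dk sk.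
  have [_ _ minf] := hf n.+1 (leq_trans hn (leqnSn _)) (leq_trans n2n (leqnSn _)).
  have fh : f n.+1 <= h by rewrite leqNgt; apply/negP => /(minf _ dh); rewrite sh.
  split; first exact: leq_trans (leq_trans fh hk) kj.
  move=> dead; apply: leq_ltn_trans fh _.
  move: kj; rewrite leq_eqVlt => /predU1P [e|]; last exact: leq_ltn_trans hk.
  by rewrite -e in dead *; exact: lt.
have [i4 h4 c4] := @nonincreasing_stabilizes f n3 (fun n hn => (fstep n hn).1).
have [[|n]] := io i4.+1; first by rewrite ltn0.
rewrite ltnS => hn /=; have n3n := leq_trans h4 hn.
have [_ strict] := fstep n n3n.
(* As [f] is constant by now, no death occurs up to rank [f n]. Since [f n] is at least [d] and
   below [#|S|], even the capped value in [rank_priority] differs from [d.*2]. *)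
have dead : f n < first_dead (G n).
  rewrite ltnNge; apply/negP => /strict; rewrite !c4 ?ltnn //.
  exact: leq_trans hn (leqnSn _).
move: (n3n); rewrite geq_max => /andP [hn1 n2n].
have [df /lab_size sf _] := hf n hn1 n2n.
have := leq_trans sf (size_safra n); rewrite /rank_priority.
by case: ifP => _; rewrite /minn; [|case: ifP => _]; lia.
Qed.

Lemma safra_correct :
  ~ parity_even safra_priority <->
  exists s : nat -> S, [/\ s 0 \in I, forall j, E j (s j) (s j.+1)
                         & forall i, exists2 j, i <= j & s j \in F].
Proof.
split.
  move/(parity_even_notP safra_priority_le) => [p [i0 [op io ge]]].
  exact: (safra_sound op io ge).
move=> [s [s0 sE sF]]; apply/(parity_even_notP safra_priority_le).
have [p [i0 [io ge]]] := liminf_exists safra_priority_le.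
exists p, i0; split=> //; apply: contrapT => /negP ep.
have e : p = p./2.*2 by rewrite -[LHS]odd_double_half (negbTE ep).
by rewrite e in io ge; exact: (safra_complete s0 sE sF io ge).
Qed.

End SafraRun.

(** * Deterministic automata for traces *)

Section LastSuch.
Variable m : nat.
Implicit Type P : pred 'I_m.

Definition last_such P : option 'I_m := [pick i | P i && [forall j, P j ==> (j <= i)]].

Lemma last_suchP P i : last_such P = Some i -> P i /\ forall j, P j -> j <= i.
Proof.
rewrite /last_such; case: pickP => // j /andP [Pj /forallP maxj] [<-].
by split=> // k Pk; have := maxj k; rewrite Pk.
Qed.

Lemma last_such_ex P i : P i -> exists j, last_such P = Some j.
Proof.
move=> Pi; rewrite /last_such; case: pickP => [j _|none]; first by exists j.
case: (@arg_maxnP _ i P (@nat_of_ord m) Pi) => j Pj maxj.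
have := none j; rewrite Pj /=; case/forallP => k; apply/implyP; exact: maxj.
Qed.

End LastSuch.

Section SafraCode.
Variable S : finType.
Implicit Types (L : seq {set S}).

Notation lab L i := (nth set0 L i).
Notation rank := 'I_#|S|.

(* A laminar family is recovered from the youngest set containing each element
   and, for each set, the youngest older set containing it. *)
Definition safra_code : finType :=
  ({ffun S -> option rank} * {ffun rank -> option rank})%type.

Definition encode L : safra_code :=
  ([ffun s => last_such (fun i : rank => s \in lab L i)],
   [ffun i : rank => last_such (fun j : rank => (j < i) && (lab L i \subset lab L j))]).

Fixpoint ancestors (parent : {ffun rank -> option rank}) n (h : rank) : seq rank :=
  if n is n'.+1 then
    h :: (if parent h is Some h' then ancestors parent n' h' else [::])
  else [::].

Definition code_label (c : safra_code) (i : rank) : {set S} :=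
  [set s | if c.1 s is Some h then i \in ancestors c.2 #|S| h else false].

Definition decode (c : safra_code) : seq {set S} :=
  [seq B <- [seq code_label c i | i <- enum rank] | B != set0].

(** Parents have strictly smaller rank, so fuel above [h] exhausts the chain. Labels sharing [s] are
    nested, so any older label around label [h] is its parent or contains that parent. *)
Lemma mem_ancestors L n (h i : rank) s : laminar L -> h < n -> s \in lab L h ->
  (i \in ancestors (encode L).2 n h) = (i <= h) && (lab L h \subset lab L i).
Proof.
move=> lamL; elim: n h => // n IH h hn sh; rewrite /= inE ffunE.
have [->|ne] := eqVneq i h; first by rewrite leqnn subxx.
set P := fun j : rank => _.
case e: (last_such P) => [j|].
  have [/andP [jh hj] maxj] := last_suchP e.
  have sj : s \in lab L j by exact: (subsetP hj).
  rewrite /= IH ?(leq_trans jh) // [i <= h]leq_eqVlt (inj_eq val_inj) (negbTE ne) /=.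
  apply/andP/andP => [[ij ji]|[ih hi]]; first by rewrite (leq_ltn_trans ij jh) (subset_trans hj).
  have ij : i <= j by apply: maxj; rewrite /P ih.
  split=> //; move: ij; rewrite leq_eqVlt => /predU1P [->//|ij].
  by apply: lamL ij _ _ sj; exact: (subsetP hi).
rewrite /= in_nil [i <= h]leq_eqVlt (inj_eq val_inj) (negbTE ne) /=.
by apply/esym/negP => /(@last_such_ex _ P) [j]; rewrite e.
Qed.

Lemma code_label_encode L i : laminar L -> code_label (encode L) i = lab L i.
Proof.
move=> lamL; apply/setP => s; rewrite inE ffunE.
case e: last_such => [h|]; last first.
  apply/esym/negP => si.
  by have [j] := @last_such_ex _ (fun i : rank => s \in lab L i) i si; rewrite e.
have [sh maxh] := last_suchP e.
rewrite (mem_ancestors _ lamL (ltn_ord h) sh); apply/andP/idP => [[_ /subsetP]|si].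
  exact.
have ih := maxh _ si; split=> //; move: ih; rewrite leq_eqVlt => /predU1P [->//|ih].
exact: lamL ih _ si sh.
Qed.

Lemma encodeK L : laminar L -> size L <= #|S| ->
  (forall i, i < size L -> lab L i != set0) -> decode (encode L) = L.
Proof.
move=> lamL sL L0.
have -> : decode (encode L) = [seq B <- mkseq (nth set0 L) #|S| | B != set0].
  rewrite /decode /mkseq -val_enum_ord -map_comp; congr filter.
  by apply: eq_map => i; exact: code_label_encode.
rewrite /mkseq -(subnKC sL) iotaD map_cat filter_cat.
rewrite -/(mkseq (nth set0 L) (size L)) mkseq_nth add0n.
rewrite (all_filterP _); last by apply/(all_nthP set0) => i; exact: L0.
rewrite -[RHS]cats0; congr cat; apply/eqP; rewrite -[_ == _]negbK -has_filter.
apply/hasPn => _ /mapP [i + ->]; rewrite mem_iota => /andP [h _].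
by rewrite nth_default ?eqxx.
Qed.

Lemma card_safra_code : #|safra_code| = (#|S| + 1) ^ (2 * #|S|).
Proof.
by rewrite card_prod !card_ffun card_option card_ord addn1 mul2n -addnn expnD.
Qed.

End SafraCode.

(** Priorities arise on transitions but must be read off states, so a state pairs a code with the
    last priority; this is the factor [2 * #|S| + 1]. *)
Lemma determinization (S : finType) (Lt : Type) (I F : {set S}) (E : Lt -> rel S) :
  I != set0 ->
  exists (D : finType) (d0 : D) (step : D -> Lt -> D) (pr : D -> nat),
    [/\ #|D| <= (#|S| + 1) ^ (2 * #|S|) * (2 * #|S| + 1),
        forall d, pr d <= 2 * #|S|
      & forall a : nat -> Lt,
          ~ parity_even (fun n => pr (foldl step d0 (mkseq a n))) <->
          exists s : nat -> S, [/\ s 0 \in I, forall j, E (a j) (s j) (s j.+1)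
                                 & forall i, exists2 j, i <= j & s j \in F]].
Proof.
move=> I0; pose m := #|S|.
pose D : finType := (safra_code S * 'I_(2 * m).+1)%type.
pose step (d : D) l : D :=
  let G := grow (E l) F (decode d.1) in (encode (collapse G), inord (rank_priority G)).
pose d0 : D := (encode [:: I], ord0).
exists D, d0, step, (fun d => nat_of_ord d.2); split.
- by rewrite card_prod card_ord card_safra_code !addn1.
- by case=> c p /=; rewrite -ltnS.
move=> a; pose Ea n := E (a n).
have inv n : let d := foldl step d0 (mkseq a n) in
    decode d.1 = safra_run I F Ea n /\ d.2 = safra_priority I F Ea n :> nat.
  elim: n => [|n [IH1 IH2]].
    split=> //; apply: encodeK => /=; first by move=> i [|j] // ij s _; rewrite /= nth_nil inE.
      by case/set0Pn: I0 => s _; apply/card_gt0P; exists s.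
    by case.
  rewrite mkseqS -cats1 foldl_cat /= IH1; split.
    have lamG := @grow_laminar _ (Ea n) F _ (@safra_laminar _ I F Ea n).
    apply: encodeK; [exact: collapse_laminar | exact: size_collapse | move=> i ilt].
    by have [s si _] := collapse_own lamG ilt; apply/set0Pn; exists s.
  by rewrite inordK // ltnS mul2n; exact: (safra_priority_le F Ea I0 n.+1).
rewrite -(safra_correct F Ea I0).
suff -> : (fun n => nat_of_ord (foldl step d0 (mkseq a n)).2) = safra_priority I F Ea by [].
by apply: funext => n; have [] := inv n.
Qed.

(* The complement automaton guesses a trace and an odd value p that is to be
   its least recurrent priority.  The least priority of all doubles as the value
   carried before the guess, as it imposes no constraint on the trace; this keeps
   the number of states down to the number of pairs. *)
Lemma trace_automaton (Q : finType) (q0 : Q) (Om : Q -> nat) :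
  let nw := #|Q| * size (undup (codom Om)) in
  exists (D : finType) (d0 : D) (step : D -> {set Q * Q} -> D) (pr : D -> nat),
    [/\ #|D| <= (nw + 1) ^ (2 * nw) * (2 * nw + 1),
        forall d, pr d <= 2 * nw
      & forall a : nat -> {set Q * Q},
          parity_even (fun n => pr (foldl step d0 (mkseq a n))) <->
          forall q : nat -> Q, q 0 = q0 -> (forall i, (q i, q i.+1) \in a i) ->
            parity_even (fun i => Om (q i))].
Proof.
pose ps := undup (codom Om); pose P := seq_sub ps.
have mem_ps q : Om q \in ps by rewrite mem_undup codom_f.
pose c0 : P := SeqSub (mem_ps q0).
pose cm : P := [arg min_(c < c0) val c].
have cmP (c : P) : val cm <= val c.
  by rewrite /cm; case: arg_minnP => // c' _; exact.
pose S : finType := (Q * P)%type.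
pose I : {set S} := [set s | s.1 == q0].
pose F : {set S} := [set s | (Om s.1 == val s.2) && odd (val s.2)].
pose E (R : {set Q * Q}) : rel S := fun s t =>
  [&& (s.1, t.1) \in R, (t.2 == s.2) || (s.2 == cm) & val t.2 <= Om t.1].
have I0 : I != set0 by apply/set0Pn; exists (q0, c0); rewrite inE.
have cardS : #|S| = #|Q| * size ps by rewrite card_prod card_seq_sub ?undup_uniq.
move=> nw; rewrite {}/nw -/ps -cardS.
have [D [d0 [step [pr [h1 h2 h3]]]]] := determinization F E I0.
exists D, d0, step, pr; split=> // a.
have bound (q : nat -> Q) i : Om (q i) <= \max_q Om q by exact: leq_bigmax.
split=> [pe q q00 qa|all].
  apply: contrapT => /(parity_even_notP (bound q)) [p [i0 [op io ge]]].
  suff: ~ parity_even (fun n => pr (foldl step d0 (mkseq a n))) by [].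
  apply/h3; have pps : p \in ps by have [j _ <-] := io 0.
  pose c : P := SeqSub pps.
  exists (fun i => (q i, if i0 <= i then c else cm)); split.
  - by rewrite inE q00.
  - move=> j; rewrite /E /= qa /=; apply/andP; split.
      case: (leqP i0 j) => [h|_]; last by rewrite eqxx orbT.
      by rewrite (leq_trans h (leqnSn _)) eqxx.
    by case: (leqP i0 j.+1) => h; [exact: ge | exact: (cmP (SeqSub (mem_ps _)))].
  - move=> i; have [j] := io (maxn i i0); rewrite geq_max => /andP [ij i0j] e.
    by exists j; rewrite // inE /= i0j e eqxx.
apply: contrapT => /h3 [s [s0 sE sF]].
(* The guess can change only while it equals [cm], so it is eventually constant. *)
have [c [i0 hc]] : exists c i0, forall i, i0 <= i -> (s i).2 = c.
  have [[i0 ne]|no] := EM (exists i, (s i).2 <> cm).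
    exists (s i0).2, i0 => i /subnKC <-; elim: (i - i0) => [|k IH]; first by rewrite addn0.
    rewrite addnS; have /and3P [_ + _] := sE (i0 + k).
    by rewrite IH => /orP [/eqP //|/eqP e]; case: ne.
  by exists cm, 0 => i _; apply: contrapT => ne; apply: no; exists i.
have := all (fun i => (s i).1); apply: contraPP => _ /=.
suff np : ~ parity_even (fun i => Om (s i).1).
  apply/not_implyP; split; first by move: s0; rewrite inE => /eqP.
  by apply/not_implyP; split=> // i; have /and3P [] := sE i.
apply/(parity_even_notP (bound (fun i => (s i).1))).
(* [E] constrains only the target of a step, so the lower bound on priorities starts one position
   later. *)
exists (val c), i0.+1; split.
- by have [j ij] := sF i0; rewrite inE (hc _ ij) => /andP [].
- move=> i; have [j ij] := sF (maxn i i0); rewrite inE geq_max in ij *; case/andP: ij => ij i0j.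
  by rewrite (hc _ i0j) => /andP [/eqP e _]; exists j.
by move=> [|i] // h; have /and3P [_ _] := sE i; rewrite hc // ltnW.
Qed.

(** * Positional strategies *)

Section Rank.
Variables (X : Type) (R : X -> X -> Prop).
Hypothesis R_wf : well_founded R.

(* Comparison of the ordinal ranks of a well-founded relation, without
   ordinals. *)
Inductive rank_le x y : Prop :=
  RankLe of (forall x', R x' x -> exists2 y', R y' y & rank_le x' y').

Definition rank_lt x y := exists2 y', R y' y & rank_le x y'.

Lemma rank_leP x y :
  rank_le x y <-> forall x', R x' x -> exists2 y', R y' y & rank_le x' y'.
Proof. by split=> [[]|]. Qed.

Lemma rank_le_sub x y : (forall z, R z x -> R z y) -> rank_le x y.
Proof.
elim: x / (R_wf x) y => x _ IH y sub; constructor=> z zx.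
by exists z; [exact: sub | apply: IH].
Qed.

Lemma rank_le_trans y x z : rank_le x y -> rank_le y z -> rank_le x z.
Proof.
elim: x / (R_wf x) y z => x _ IH y z /rank_leP xy /rank_leP yz.
constructor=> x' /[dup] x'x /xy [y' /yz [z' z'z yz'] xy'].
by exists z'; last exact: IH xy' yz'.
Qed.

(** If [y] is not below [x], some predecessor [y'] of [y] is below no predecessor of [x]; by
    induction all of these are strictly below [y'], so [x] is at most [y']. *)
Lemma rank_ltNge x y : rank_lt x y <-> ~ rank_le y x.
Proof.
split=> [[y' y'y] xy'|].
  elim: x / (R_wf x) y y' y'y xy' => x _ IH y y' y'y xy' /rank_leP /(_ _ y'y) [x' x'x yx'].
  by have /rank_leP /(_ _ x'x) [y'' y''y' x'y''] := xy'; exact: (IH _ x'x y' y'').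
elim: y / (R_wf y) x => y _ IH x nle; apply: contrapT => nlt.
apply: nle; constructor=> y' y'y; apply: contrapT => none; apply: nlt.
exists y' => //; constructor=> x' x'x.
by apply: (IH _ y'y) => le; apply: none; exists x'.
Qed.

(** [rank_lt] relates elements that [R] does not, so accessibility is proved for everything of rank
    at most that of [x], by induction along [R]. *)
Lemma rank_lt_wf : well_founded rank_lt.
Proof.
move=> x; have : rank_le x x by exact: rank_le_sub.
move: {-2}x; elim: x / (R_wf x) => x _ IH y yx; constructor=> z [y' y'y zy'].
have /rank_leP /(_ _ y'y) [x' x'x yx'] := yx.
exact: IH x'x _ (rank_le_trans zy' yx').
Qed.

End Rank.

Section LexLeast.
Variable X : Type.
Implicit Types le : X -> X -> Prop.

Definition well_preorder le : Prop :=
  (forall y x z, le x y -> le y z -> le x z) /\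
  forall P : X -> Prop, (exists x, P x) -> exists2 x, P x & forall y, P y -> le x y.

Definition lexi le1 le2 x y : Prop := le1 x y /\ (le1 y x -> le2 x y).

Lemma well_preorder_lexi le1 le2 :
  well_preorder le1 -> well_preorder le2 -> well_preorder (lexi le1 le2).
Proof.
move=> [tr1 min1] [tr2 min2]; split.
  move=> y x z [xy1 xy2] [yz1 yz2]; split; first exact: tr1 yz1.
  by move=> zx1; apply: tr2 (xy2 (tr1 _ _ _ yz1 zx1)) (yz2 (tr1 _ _ _ zx1 xy1)).
move=> P /min1 [x0 Px0 minx0].
have [x [Px xx0] minx] := min2 (fun x => P x /\ le1 x x0) (ex_intro _ x0 (conj Px0 (minx0 _ Px0))).
exists x => // y Py; split; first exact: tr1 xx0 (minx0 _ Py).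
by move=> yx; apply: minx; split=> //; exact: tr1 yx xx0.
Qed.

Lemma well_preorder_rank (R : X -> X -> Prop) : well_founded R -> well_preorder (rank_le R).
Proof.
move=> wf; split=> [y x z|P [x Px]]; first exact: rank_le_trans.
elim: x / (rank_lt_wf wf x) Px => x _ IH Px.
have [[y Py yx]|none] := EM (exists2 y, P y & rank_lt R y x); first exact: IH yx Py.
exists x => // y Py; apply: contrapT => nle; apply: none; exists y => //.
exact/rank_ltNge.
Qed.

End LexLeast.

Section Positional.
Variables (X V : Type) (step : X -> X -> Prop) (c : X -> nat) (v : X -> V) (M : nat).
Hypothesis cM : forall x, c x <= M.
Hypothesis cv : forall x y, v x = v y -> c x = c y.
Hypothesis even_plays : forall x : nat -> X, (forall i, step (x i) (x i.+1)) ->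
  parity_even (fun i => c (x i)).

Fixpoint reaches p n x y : Prop :=
  if n is n'.+1 then exists z, [/\ step x z, p <= c z & reaches p n' z y]
  else step x y /\ c y = p.

(** The rank of [x] for this relation measures how often [p] can still be visited from [x] before a
    smaller priority occurs. *)
Definition below p y x : Prop := exists n, reaches p n x y.

(** An infinite descent concatenates into a play on which the odd [p] recurs and nothing smaller is
    met after the start. The pairs record a vertex and the number of steps left before the next
    visit to [p]. *)
Lemma below_wf p : odd p -> well_founded (below p).
Proof.
move=> op x0; apply: contrapT => nacc0.
pose good (un : X * nat) := exists2 y, ~ Acc (below p) y & reaches p un.2 un.1 y.
have start x : ~ Acc (below p) x -> exists n, good (x, n).
  move=> nacc; apply: contrapT => none; apply: nacc; constructor=> y [n xy].
  by apply: contrapT => nacc; apply: none; exists n, y.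
have next (un : {un | good un}) : exists un' : {un | good un},
    [/\ step (sval un).1 (sval un').1, p <= c (sval un').1
      & if (sval un).2 is n.+1 then (sval un').2 = n else c (sval un').1 = p].
  case: un => -[u [|n]] /= [y nacc /=].
    move=> [uy cy]; have [n gy] := start _ nacc.
    by exists (exist good (y, n) gy); rewrite /= cy.
  move=> [z [uz cz zy]]; have gz : good (z, n) by exists y.
  by exists (exist good (z, n) gz).
have {next} [f hf] := choice next.
have [n0 g0] := start _ nacc0.
pose s i := sval (iter i f (exist good (x0, n0) g0)).
have hs i : [/\ step (s i).1 (s i.+1).1, p <= c (s i.+1).1
      & if (s i).2 is n.+1 then (s i.+1).2 = n else c (s i.+1).1 = p] by exact: hf.
have : parity_even (fun i => c (s i).1) by apply: even_plays => i; have [] := hs i.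
have bound i : c (s i).1 <= M by [].
suff : ~ parity_even (fun i => c (s i).1) by [].
apply/(parity_even_notP bound); exists p, 1; split=> //; last first.
  by move=> [|i] // _; have [] := hs i.
move=> i; have [n en] : exists n, (s i).2 = n by exists (s i).2.
elim: n i en => [|n IH] i en; have [_ _] := hs i; rewrite en => h.
  by exists i.+1.
by have [j ij cj] := IH _ h; exists j => //; exact: ltnW.
Qed.

(** These are the signatures, or progress measures, of parity games: the ranks for all odd
    priorities under [p], compared lexicographically from the smallest priority on. *)
Fixpoint sig_le p : X -> X -> Prop :=
  if p is p'.+1 then
    lexi (sig_le p') (if odd p' then rank_le (below p') else fun _ _ => True)
  else fun _ _ => True.

Lemma well_preorder_sig p : well_preorder (sig_le p).
Proof.
have triv : well_preorder (fun _ _ : X => True).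
  by split=> // P [x Px]; exists x.
elim: p => [|p IH] //=; apply: well_preorder_lexi => //.
by case: ifP => // op; exact/well_preorder_rank/below_wf.
Qed.

Lemma sig_le_mono p q x y : p <= q -> sig_le q x y -> sig_le p x y.
Proof.
move=> /subnK <-; elim: (q - p) => [|k IH] //.
by rewrite addSn => -[/IH].
Qed.

Lemma below_step p x y : odd p -> step x y -> p <= c y -> rank_le (below p) y x.
Proof.
move=> op xy py; apply: rank_le_sub => [|z [n yz]]; first exact: below_wf.
by exists n.+1, y.
Qed.

Lemma sig_step x y p : step x y -> p <= c y -> sig_le p.+1 y x.
Proof.
move=> xy; elim: p => [|p IH] h; split=> //; try exact/IH/ltnW; move=> _.
by case: ifP => // op; exact: below_step.
Qed.

(** The vertex [y] is itself a visit to its priority from [x], so that rank drops strictly while the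
    earlier ones do not grow. *)
Lemma sig_step_odd x y : step x y -> odd (c y) -> ~ sig_le (c y).+1 x y.
Proof.
move=> xy oy [h1]; rewrite oy => /(_ (sig_le_mono (leqnSn _) (sig_step xy (leqnn _)))).
have wf := below_wf oy; apply/(rank_ltNge wf).
by exists y; [exists 0 | exact: (rank_le_sub wf)].
Qed.

(* The move made at a vertex is the one made at an occurrence of this vertex
   whose signature is least; signatures then decrease along the plays. *)
Lemma positional_plays (x0 : X) : exists pick : V -> X,
  (forall x, v (pick (v x)) = v x) /\
  forall y : nat -> X,
    (forall i, y i = pick (v (y i))) ->
    (forall i, exists2 z, step (y i) z & v z = v (y i.+1)) ->
    parity_even (fun i => c (y i)).
Proof.
have [tr least] := well_preorder_sig M.+1.
have /choice [pick hp] w : exists x, forall x', v x' = w ->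
    v x = w /\ sig_le M.+1 x x'.
  have [[x' vx']|none] := EM (exists x, v x = w); last first.
    by exists x0 => x' vx'; case: none; exists x'.
  have [x vx minx] := least (fun x => v x = w) (ex_intro _ x' vx').
  by exists x => z vz; split=> //; exact: minx.
exists pick; split=> [x|y yp ys]; first by have [] := hp (v x) x erefl.
have bound i : c (y i) <= M by [].
apply: contrapT => /(parity_even_notP bound) [p [i0 [op io ge]]].
have pM : p <= M by have [j _ <-] := io 0.
have dec i : i0 <= i -> sig_le p.+1 (y i.+1) (y i) /\
    (c (y i.+1) = p -> ~ sig_le p.+1 (y i) (y i.+1)).
  move=> hi; have [z yz vz] := ys i; have cz := cv vz.
  have [_] := hp _ z vz; rewrite -yp => /(@sig_le_mono p.+1 M.+1 _ _ pM) le.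
  have pz : p <= c z by rewrite cz; apply: ge; exact: leq_trans hi (leqnSn _).
  have [trp _] := well_preorder_sig p.+1.
  split; first exact: trp le (sig_step yz pz).
  move=> cp; rewrite -cz in cp; move=> h.
  by apply: (sig_step_odd yz); rewrite cp //; exact: trp h le.
have [trp leastp] := well_preorder_sig p.+1.
(* The tail of the play attains a least signature. Beyond it all signatures are equivalent, yet each
   visit to [p] would make them drop. *)
have [_ [j hj <-] minj] := leastp (fun x => exists2 i, i0 <= i & y i = x)
  (ex_intro _ (y i0) (ex_intro2 _ _ i0 (leqnn _) erefl)).
have below_j i : j <= i -> sig_le p.+1 (y i) (y j).
  move=> /subnK <-; elim: (i - j) => [|k IH]; first by apply: minj; exists j.
  by rewrite addSn; apply: trp IH; apply: (dec _ _).1; apply: leq_trans hj (leq_addl _ _).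
have [[|i]] := io j.+1; first by rewrite ltn0.
rewrite ltnS => ji ci; apply: (dec i (leq_trans hj ji)).2 ci _.
apply: trp (below_j _ ji) _; apply: minj; exists i.+1 => //.
exact: leq_trans (leq_trans hj ji) (leqnSn _).
Qed.

End Positional.

Lemma infinitely_often_shift (u : nat -> nat) k p :
  infinitely_often (fun i => u (k + i)) p <-> infinitely_often u p.
Proof.
split=> io i.
  by have [j ij <-] := io i; exists (k + j) => //; exact: leq_trans ij (leq_addl _ _).
have [j ij <-] := io (k + i); exists (j - k); first by lia.
by rewrite subnKC // (leq_trans (leq_addr _ _) ij).
Qed.

Lemma parity_even_shift (u : nat -> nat) k :
  parity_even u -> parity_even (fun i => u (k + i)).
Proof.
move=> [p [io minp ep]]; exists p; split=> //; first exact/infinitely_often_shift.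
by move=> p' /infinitely_often_shift; exact: minp.
Qed.

Section Play.
Variables (Sigma : finType) (A : aapta Sigma) (T : labelled_tree Sigma).
Implicit Types (x : exec_word A T) (m : seq (dir T)) (q : state A) (d : dir T).

Lemma exec_node_rcons x d q : exec_node (rcons x (d, q)) = rcons (exec_node x) d.
Proof. exact: map_rcons. Qed.

Lemma exec_state_rcons x d q : exec_state (rcons x (d, q)) = q.
Proof. by rewrite /exec_state /unzip2 map_rcons last_rcons. Qed.

Lemma positional_strategy : language A T ->
  exists (W : seq (dir T) -> state A -> Prop)
         (sg : seq (dir T) -> state A -> dir T -> {set state A}),
  [/\ W [::] (init A),
      forall m q, W m q ->
        [/\ tree T m,
            marking_sat (fun d : successor m => sg m q (val d)) (delta A q (label T m))
          & forall d q', q' \in sg m q d -> W (rcons m d) q']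
    & forall (b : nat -> dir T) (q : nat -> state A), q 0 = init A ->
        (forall i, q i.+1 \in sg (mkseq b i) (q i) (b i)) ->
        parity_even (fun i => priority A (q i))].
Proof.
move=> [e exe acc].
pose X := {x : exec_word A T | e x}.
pose v (x : X) := (exec_node (val x), exec_state (val x)).
pose step (x y : X) := exists dq, val y = rcons (val x) dq.
pose c (x : X) := priority A (exec_state (val x)).
have cM (x : X) : c x <= \max_q priority A q by exact: (leq_bigmax (exec_state (val x))).
have cv (x y : X) : v x = v y -> c x = c y by case=> _; rewrite /c => ->.
have plays (x : nat -> X) : (forall i, step (x i) (x i.+1)) ->
    parity_even (fun i => c (x i)).
  (* A play may start at any occurrence. Prefixing the word [w] of its first vertex makes it an
     infinite branch, and the parity condition ignores prefixes. *)
  move=> /choice [dq hdq]; pose w := val (x 0).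
  pose b j := if j < size w then nth (dq 0) w j else dq (j - size w).
  have bx i : mkseq b (size w + i) = val (x i).
    elim: i => [|i IH]; last by rewrite addnS mkseqS IH /b ltnNge leq_addr /= addKn hdq.
    rewrite addn0; apply: (@eq_from_nth _ (dq 0)); rewrite size_mkseq // => j jw.
    by rewrite nth_mkseq // /b jw.
  have eb : infinite_branch e b.
    move=> j; apply: (@node_prefix _ e _ (drop j (mkseq b (size w + j)))).
    have -> : mkseq b j = take j (mkseq b (size w + j)).
      by rewrite /mkseq -map_take take_iota; congr [seq _ | _ <- iota _ _]; lia.
    by rewrite cat_take_drop bx; exact: (valP (x j)).
  have := parity_even_shift (size w) (acc _ eb).
  rewrite (_ : (fun i => _) = fun i => c (x i)) //.
  by apply: funext => i; rewrite bx.
pose mk z (h : e z) : X := exist (fun x => e x) z h.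
pose x0 : X := mk _ (node_root e).
have [pick [pickP pe]] := positional_plays cM cv plays x0.
pose y m q := val (pick (m, q)).
exists (fun m q => exists x : X, v x = (m, q)),
  (fun m q d => [set q' | e (rcons (y m q) (d, q'))]).
have yP m q : (exists x : X, v x = (m, q)) -> exec_node (y m q) = m /\ exec_state (y m q) = q.
  by case=> x vx; have := pickP x; rewrite vx => -[].
have next m q d q' : (exists x : X, v x = (m, q)) -> forall (h : e (rcons (y m q) (d, q'))),
    v (mk _ h) = (rcons m d, q').
  by move=> /yP [ym _] h; rewrite /v /= exec_node_rcons exec_state_rcons ym.
split; first by exists x0.
  move=> m q mq; have [ym yq] := yP _ _ mq.
  have [ty sat] := exe _ (valP (pick (m, q))).
  (* The type of successors depends on the node, so the node and the state are generalized before
     rewriting with [ym] and [yq]. *)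
  have gen m' q' : exec_node (y m q) = m' -> exec_state (y m q) = q' ->
      tree T m' /\ marking_sat (fun d : successor m' => [set q'' | e (rcons (y m q) (val d, q''))])
        (delta A q' (label T m')) by move=> <- <-.
  have [tm sm] := gen _ _ ym yq; split=> // d q'; rewrite inE => h.
  by exists (mk _ h); exact: next.
move=> b q q0 qs.
have vP i : exists x : X, v x = (mkseq b i, q i).
  elim: i => [|i IH]; first by exists x0; rewrite /v /= q0.
  have := qs i; rewrite inE => h; exists (mk _ h).
  by rewrite next // mkseqS.
have vy i : v (pick (mkseq b i, q i)) = (mkseq b i, q i).
  by have [x vx] := vP i; rewrite -vx pickP.
have := pe (fun i => pick (mkseq b i, q i)).
rewrite (_ : (fun i => c _) = fun i => priority A (q i)); last first.
  by apply: funext => i; have := vy i; rewrite /c => -[_ ->].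
apply=> i; first by rewrite vy.
have := qs i; rewrite inE => h; exists (mk _ h); first by exists (b i, q i.+1).
by rewrite vy next // mkseqS.
Qed.

End Play.

(** * Satisfaction of EU-pairs *)

(** A product type brings the decidable equality that membership in lists of clauses requires. *)
Definition atom (S : finType) := (multiset S * {set S})%type.
Definition pair_of_atom (S : finType) (p : atom S) : eu_pair S := EUPair p.1 p.2.

(** The singleton case keeps [EUBot] out of nonempty disjunctions, where [pair_disjunction] would
    reject it. *)
Fixpoint disjunction (S : finType) (ps : seq (atom S)) : eu_constraint S :=
  match ps with
  | [::] => EUBot
  | [:: p] => EUAtom (pair_of_atom p)
  | p :: ps' => EUOr (EUAtom (pair_of_atom p)) (disjunction ps')
  end.

Fixpoint dnf (S : finType) (f : eu_constraint S) : seq (seq (atom S)) :=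
  match f with
  | EUTop => [:: [::]]
  | EUBot => [::]
  | EUAtom p => [:: [:: (eu_E p, eu_U p)]]
  | EUAnd f1 f2 => [seq C1 ++ C2 | C1 <- dnf f1, C2 <- dnf f2]
  | EUOr f1 f2 => dnf f1 ++ dnf f2
  end.

Section Constraints.
Variable S : finType.
Implicit Types (f : eu_constraint S) (p : atom S) (ps : seq (atom S)).

Lemma disjunction_cons p p' ps :
  disjunction [:: p, p' & ps] = EUOr (EUAtom (pair_of_atom p)) (disjunction (p' :: ps)).
Proof. by []. Qed.

Lemma pair_disjunction_disjunction p ps : pair_disjunction (disjunction (p :: ps)).
Proof. by elim: ps p => // p' ps IH p; exact: IH. Qed.

Lemma nonalternating_disjunction ps : nonalternating_constraint (disjunction ps).
Proof.
by case: ps => // p [|p' ps] //; exact: (@pair_disjunction_disjunction p (p' :: ps)).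
Qed.

Lemma eu_size_disjunction ps : eu_size (disjunction ps) <= maxn 1 (2 * size ps).
Proof.
case: ps => // p ps; apply: leq_trans (leq_maxr _ _).
by elim: ps p => // p' ps IH p; rewrite disjunction_cons /=; have /= := IH p'; lia.
Qed.

Lemma eu_pairs_disjunction ps : eu_pairs (disjunction ps) = map (@pair_of_atom S) ps.
Proof. by elim: ps => // p [|p' ps] IH //; rewrite disjunction_cons [LHS]/= IH. Qed.

Lemma eu_size_gt0 f : 0 < eu_size f.
Proof. by case: f. Qed.

Lemma size_dnf f : size (dnf f) <= 2 ^ (eu_size f - 1).
Proof.
elim: f => //= [f1 IH1 f2 IH2|f1 IH1 f2 IH2]; rewrite subn1 /=.
  rewrite size_allpairs; apply: leq_trans (leq_mul IH1 IH2) _.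
  by rewrite -expnD leq_exp2l //; lia.
have h1 := eu_size_gt0 f1; have h2 := eu_size_gt0 f2.
rewrite size_cat; apply: leq_trans (leq_add IH1 IH2) _.
have -> : eu_size f1 + eu_size f2 = (eu_size f1 - 1 + eu_size f2).+1 by lia.
rewrite expnS mul2n -addnn leq_add // leq_exp2l //; lia.
Qed.

Lemma size_dnf_clause f C : C \in dnf f -> size C <= eu_size f.
Proof.
elim: f C => /= [C|C|p C|f1 IH1 f2 IH2 C|f1 IH1 f2 IH2 C]; rewrite ?inE //.
- by move/eqP ->.
- by move/eqP ->.
- by case/allpairsP=> [[C1 C2] [/= /IH1 h1 /IH2 h2 ->]]; rewrite size_cat; lia.
by rewrite mem_cat => /orP [/IH1|/IH2]; lia.
Qed.

Lemma dnf_atom_le (g : eu_pair S -> nat) f C p : C \in dnf f -> p \in C ->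
  g (pair_of_atom p) <= \max_(p' <- eu_pairs f) g p'.
Proof.
elim: f C => /= [C|C|p' C|f1 IH1 f2 IH2 C|f1 IH1 f2 IH2 C]; rewrite ?inE //.
- by move/eqP ->.
- by move/eqP ->; rewrite inE => /eqP ->; rewrite big_seq1; case: p'.
- rewrite big_cat /= leq_max.
  case/allpairsP=> [[C1 C2] [/= C1f C2f ->]]; rewrite mem_cat.
  by case/orP=> [/(IH1 _ C1f) ->|/(IH2 _ C2f) ->]; rewrite ?orbT.
rewrite big_cat /= leq_max mem_cat.
by case/orP=> [/IH1 h /h ->|/IH2 h /h ->]; rewrite ?orbT.
Qed.

Section Marking.
Variable S' : finType.
Implicit Type nu : marking S S'.

Definition atom_sat nu p : Prop := marking_sat nu (EUAtom (pair_of_atom p)).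

Lemma atom_sat_mono nu1 nu2 p : (forall c, nu1 c \subset nu2 c) ->
  atom_sat nu1 p -> atom_sat nu2 p.
Proof. by move=> sub [n un sn]; exists n => // c; apply: (subsetP (sub c)). Qed.

Lemma disjunction_sat nu ps :
  marking_sat nu (disjunction ps) <-> exists2 p, p \in ps & atom_sat nu p.
Proof.
elim: ps => [|p [|p' ps] IH]; first by split=> [|[]].
  by split=> [h|[p' + h]]; [exists p; rewrite ?mem_head | rewrite inE => /eqP <-].
rewrite disjunction_cons; split=> [[h|/IH [p0 p0p h]]|[p0]].
- by exists p; rewrite ?mem_head.
- by exists p0; rewrite // inE p0p orbT.
rewrite inE => /predU1P [->|p0p] h; first by left.
by right; apply/IH; exists p0.
Qed.

Lemma dnfP nu f :
  marking_sat nu f <-> exists2 C, C \in dnf f & forall p, p \in C -> atom_sat nu p.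
Proof.
elim: f => /= [||p|f1 IH1 f2 IH2|f1 IH1 f2 IH2].
- by split=> // _; exists [::].
- by split=> // -[].
- split=> [h|[C]]; last by rewrite inE => /eqP -> /(_ _ (mem_head _ _)); case: p.
  by eexists; first exact: mem_head; move=> p'; rewrite inE => /eqP ->; case: p h.
- split=> [[/IH1 [C1 C1f h1] /IH2 [C2 C2f h2]]|[C /allpairsP [[C1 C2] [/= C1f C2f ->]] h]].
    exists (C1 ++ C2); first by apply/allpairsP; exists (C1, C2).
    by move=> p; rewrite mem_cat => /orP [/h1|/h2].
  split; [apply/IH1; exists C1 => // p pC | apply/IH2; exists C2 => // p pC];
    by apply: h; rewrite mem_cat pC ?orbT.
split=> [[/IH1|/IH2] [C Cf h]|[C]].
- by exists C; rewrite ?mem_cat ?Cf.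
- by exists C; rewrite ?mem_cat ?Cf ?orbT.
by rewrite mem_cat => /orP [Cf|Cf] h; [left; apply/IH1 | right; apply/IH2]; exists C.
Qed.

Lemma sublist_image (f : S' -> S) (l : seq S) (A : {set S'}) :
  (forall s, count_mem s l <= #|[set c in A | f c == s]|) ->
  exists cs, [/\ uniq cs, map f cs = l & {subset cs <= A}].
Proof.
elim: l A => [|s l IH] A h; first by exists [::].
have /card_gt0P [c] : 0 < #|[set c in A | f c == s]|.
  by apply: leq_trans (h s); rewrite /= eqxx.
rewrite inE => /andP [cA /eqP fc].
have [s'|cs [ucs fcs sub]] := IH (A :\ c).
  have := h s'; rewrite /= (cardsD1 c [set c in A | f c == s']) inE cA fc /= leq_add2l.
  move=> h'; apply: leq_trans h' _; apply/subset_leq_card/subsetP => c'.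
  by rewrite !inE => /and3P [-> -> ->].
exists (c :: cs); split=> /=; last first.
- by move=> c'; rewrite inE => /predU1P [->//|/sub]; rewrite inE => /andP [].
- by rewrite fc fcs.
by rewrite ucs andbT; apply/negP => /sub; rewrite !inE eqxx.
Qed.

(** Multiplicities are traded for a list of distinct children that realize the elements of [E];
    overlaps between atoms can then be described child by child. *)
Lemma mset_satP (f : S' -> S) (p : eu_pair S) (l : seq S) :
  (forall s, count_mem s l = eu_E p s) ->
  mset_sat (image_multiset f) p <->
  exists cs, [/\ uniq cs, map f cs = l & forall c, c \notin cs -> f c \in eu_U p].
Proof.
move=> hl.
have cnt cs s : uniq cs -> map f cs = l -> eu_E p s = #|[set c in cs | f c == s]|.
  move=> ucs fcs; rewrite -hl -fcs count_map -size_filter.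
  rewrite -(card_uniqP (filter_uniq _ ucs)); apply: eq_card => c.
  by rewrite mem_filter !inE andbC.
have sub (cs : seq S') s : [set c in cs | f c == s] \subset [set c | f c == s].
  by apply/subsetP => c; rewrite !inE => /andP [].
split=> [/andP [/forallP le /subsetP supp]|[cs [ucs fcs hU]]].
  have [s|cs [ucs fcs _]] := @sublist_image f l setT.
    rewrite hl; apply: leq_trans (le s) _; rewrite ffunE.
    by apply/subset_leq_card/subsetP => c; rewrite !inE.
  exists cs; split=> // c ccs; apply: supp; rewrite inE !ffunE subn_gt0 (cnt cs) //.
  apply/proper_card/properP; split=> //; exists c; rewrite !inE //.
  by rewrite (negbTE ccs).
apply/andP; split.
  by apply/forallP => s; rewrite (cnt cs) // ffunE; exact/subset_leq_card.
apply/subsetP => s; rewrite inE !ffunE subn_gt0 (cnt cs s) // => lt.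
have /subsetPn [c] : ~~ ([set c | f c == s] \subset [set c in cs | f c == s]).
  by apply: contraL lt => /subset_leq_card; rewrite -leqNgt.
by rewrite !inE => /eqP <-; rewrite eqxx andbT => /hU.
Qed.

End Marking.
End Constraints.

Definition elements (S : finType) (E : multiset S) : seq S :=
  flatten [seq nseq (E s) s | s <- enum S].

Lemma count_elements (S : finType) (E : multiset S) s : count_mem s (elements E) = E s.
Proof.
rewrite /elements count_flatten -map_comp sumnE big_map big_enum /=.
rewrite (bigD1 s) //= count_nseq /= eqxx mul1n big1 ?addn0 // => s' /negbTE ne.
by rewrite count_nseq /= ne.
Qed.

Lemma size_elements (S : finType) (E : multiset S) : size (elements E) = mcard E.
Proof.
rewrite /elements size_flatten /shape -map_comp sumnE big_map big_enum /=.
by apply: eq_bigr => s _; rewrite size_nseq.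
Qed.

Definition mset_of (S : finType) (l : seq S) : multiset S := [ffun s => count_mem s l].

Lemma mcard_mset_of (S : finType) (l : seq S) : mcard (mset_of l) = size l.
Proof.
rewrite -sum1_size -[RHS](big_map id xpredT (fun=> 1)) map_id /mcard.
under eq_bigr do rewrite ffunE -sum1_count.
rewrite (exchange_big_dep xpredT) //=; apply: eq_bigr => s _.
by rewrite (big_pred1 s) // => s'; rewrite eq_sym.
Qed.

Lemma perm_map_lift (T T' : eqType) (f : T -> T') (s : seq T) (l : seq T') :
  perm_eq (map f s) l -> exists2 s', perm_eq s s' & map f s' = l.
Proof.
elim: l s => [|y l IH] s.
  by move/perm_nilP/(congr1 size); rewrite size_map; case: s => // _; exists [::].
move=> p; have : y \in map f s by rewrite (perm_mem p) mem_head.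
case/mapP=> x xs ey; have ps := perm_to_rem xs.
have [|s' ps' <-] := IH (rem x s).
  by rewrite -(perm_cons y) -(permPr p) ey; have := perm_map f ps; rewrite perm_sym.
by exists (x :: s'); rewrite ?ey // (permPl ps) perm_cons.
Qed.

Lemma mset_of_satP (S' S : finType) (f : S' -> S) l (U : {set S}) :
  mset_sat (image_multiset f) (EUPair (mset_of l) U) <->
  exists cs, [/\ uniq cs, map f cs = l & forall c, c \notin cs -> f c \in U].
Proof. by apply: mset_satP => s; rewrite ffunE. Qed.

(** * Merging EU-pairs *)

Lemma leq_sum_size (T : eqType) (l : seq T) (g : T -> nat) B :
  (forall x, x \in l -> g x <= B) -> \sum_(x <- l) g x <= size l * B.
Proof.
move=> h; rewrite big_seq; apply: leq_trans (leq_sum _ h) _.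
by rewrite -big_seq big_const_seq count_predT iter_addn_0 mulnC.
Qed.

Section Rows.
Variable Q : finType.
Local Notation rel2 := {set Q * Q}.
Implicit Types (q : Q) (r : rel2) (rho cfg : seq rel2) (es : seq Q) (U : {set Q})
  (UU : {set rel2}) (C : seq (Q * atom Q)).

(** For the children singled out by earlier atoms but not by the current one: each receives some
    state of [U]. *)
Fixpoint fill q U rho : seq (seq rel2) :=
  if rho is r :: rho' then
    [seq ((q, u) |: r) :: cfg | u <- enum U, cfg <- fill q U rho']
  else [:: [::]].

(* rho lists the relations of the children that the previous atoms single out,
   UU contains those of the other children.  Each element of es is sent either
   to one of the former or to one of the latter. *)
Fixpoint extend q U UU es rho : seq (seq rel2) :=
  if es is x :: es' then
    [seq ((q, x) |: rr.1) :: cfg |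
       rr <- [seq (r, rho) | r <- enum UU] ++ [seq (r, rem r rho) | r <- rho],
       cfg <- extend q U UU es' rr.2]
  else fill q U rho.

Fixpoint free_relations C : {set rel2} :=
  if C is qp :: C' then
    [set (qp.1, ur.1) |: ur.2 | ur in setX qp.2.2 (free_relations C')]
  else [set set0].

Fixpoint configurations C : seq (seq rel2) :=
  if C is qp :: C' then
    flatten [seq extend qp.1 qp.2.2 (free_relations C') (elements qp.2.1) rho
            | rho <- configurations C']
  else [:: [::]].

Lemma size_fill_row q U rho cfg : cfg \in fill q U rho -> size cfg = size rho.
Proof.
elim: rho cfg => [|r rho IH] cfg /=; first by rewrite inE => /eqP ->.
by case/allpairsP=> [[u c] [/= _ /IH <- ->]].
Qed.

Lemma size_extend_row q U UU es rho cfg :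
  cfg \in extend q U UU es rho -> size cfg <= size es + size rho.
Proof.
elim: es rho cfg => [|x es IH] rho cfg /=; first by move/size_fill_row ->.
case/allpairsPdep=> [rr [c [+ /IH h ->]]] /=; rewrite mem_cat => /orP [] /mapP [r rin e].
  by rewrite e /= in h.
move: h; rewrite e /= size_rem // => h; rewrite ltnS.
by apply: leq_trans h _; rewrite leq_add2l leq_pred.
Qed.

Lemma size_fill q U rho : size (fill q U rho) <= (maxn 1 #|U|) ^ size rho.
Proof.
elim: rho => //= r rho IH; rewrite size_allpairs -cardE expnS leq_mul //.
exact: leq_maxr.
Qed.

Lemma size_extend q U UU es rho :
  size (extend q U UU es rho) <=
  (size rho + #|UU|) ^ size es * (maxn 1 #|U|) ^ size rho.
Proof.
elim: es rho => [|x es IH] rho /=; first by rewrite mul1n size_fill.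
rewrite size_allpairs_dep sumnE big_map expnS -mulnA.
set l := _ ++ _; have -> : size rho + #|UU| = size l.
  by rewrite size_cat !size_map -cardE addnC.
apply: leq_sum_size => rr rrl; apply: leq_trans (IH _) _.
have le : size rr.2 <= size rho.
  move: rrl; rewrite mem_cat => /orP [] /mapP [r rin ->] //=.
  by rewrite size_rem // leq_pred.
have -> : size l = size rho + #|UU| by rewrite size_cat !size_map -cardE addnC.
apply: leq_mul; last by rewrite leq_pexp2l ?leq_max.
by case: (size es) => // k; rewrite leq_exp2r // leq_add2r.
Qed.

Lemma fill_complete (S' : finType) q U rho (G : S' -> rel2) (nu : S' -> Q) cs :
  map G cs = rho -> (forall c, c \in cs -> nu c \in U) ->
  [seq (q, nu c) |: G c | c <- cs] \in fill q U rho.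
Proof.
move=> <-; elim: cs => [|c cs IH] nuU; first exact: mem_head.
apply/allpairsP; exists (nu c, [seq (q, nu c) |: G c | c <- cs]); split=> //=.
  by rewrite mem_enum nuU ?mem_head.
by apply: IH => c' c'cs; apply: nuU; rewrite inE c'cs orbT.
Qed.

(** [old] and [new] are the children singled out by earlier atoms and by the current one. Lists
    agree only up to permutation, because [extend] puts the children of [new] first. *)
Lemma extend_complete (S' : finType) q U UU rho (G : S' -> rel2) (nu : S' -> Q) old new :
  uniq old -> perm_eq (map G old) rho -> uniq new ->
  (forall c, c \in old -> c \notin new -> nu c \in U) ->
  (forall c, c \in new -> c \notin old -> G c \in UU) ->
  exists cs, [/\ uniq cs, cs =i [predU new & old] &
    exists2 cfg, cfg \in extend q U UU (map nu new) rho
               & perm_eq [seq (q, nu c) |: G c | c <- cs] cfg].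
Proof.
move=> uold; elim: new rho old uold => [|c new IH] rho old uold pold /=.
  move=> _ oldU _; have [cs pcs gcs] := perm_map_lift pold.
  exists cs; split; first by rewrite -(perm_uniq pcs).
    by move=> c; rewrite -(perm_mem pcs).
  eexists; last exact: perm_refl.
  by apply: fill_complete => // c; rewrite -(perm_mem pcs) => cold; exact: oldU.
case/andP=> cnew unew oldU newUU.
pose old' := rem c old.
have uold' : uniq old' by exact: rem_uniq.
have mem_old' c' : c' \in old' = (c' != c) && (c' \in old).
  by rewrite mem_rem_uniq.
pose rr := if c \in old then (G c, rem (G c) rho) else (G c, rho).
have rr1 : rr.1 = G c by rewrite /rr; case: ifP.
have rr_opt : rr \in [seq (r, rho) | r <- enum UU] ++ [seq (r, rem r rho) | r <- rho].
  rewrite mem_cat /rr; case: ifPn => cold; apply/orP; [right|left]; apply/mapP; exists (G c) => //.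
    by rewrite -(perm_mem pold) map_f.
  by rewrite mem_enum newUU ?mem_head.
have pold' : perm_eq (map G old') rr.2.
  rewrite /rr /old'; case: ifPn => cold /=; last by rewrite rem_id.
  rewrite -(perm_cons (G c)); have h := perm_to_rem cold.
  have /perm_to_rem h' : G c \in rho by rewrite -(perm_mem pold) map_f.
  by rewrite -(permPr h') -(permPr pold) perm_sym; exact: (perm_map G h).
have [|c'|cs [ucs mcs [cfg hcfg pcfg]]] := IH rr.2 old' uold' pold' unew.
- move=> c'; rewrite mem_old' => /andP [ne c'old] c'new.
  by apply: oldU; rewrite // inE negb_or ne.
- move=> c'new; rewrite mem_old' negb_and negbK => /orP [/eqP e|c'old].
    by rewrite -e c'new in cnew.
  by apply: newUU; rewrite // inE c'new orbT.
exists (c :: cs); split=> /=.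
- by rewrite ucs mcs !inE mem_old' eqxx (negbTE cnew).
- move=> c'; rewrite !inE mcs !inE mem_old'.
  by case: eqVneq => [->|_] /=.
exists (((q, nu c) |: G c) :: cfg); last by rewrite perm_cons.
by apply/allpairsPdep; exists rr, cfg; rewrite rr1.
Qed.

(** The relation of a child collects the states that the witnesses of the atoms give it, and nothing
    else. Its edges therefore stay within [mu], which later makes every trace follow the
    strategy. *)
Lemma configurations_complete (S' : finType) (mu : Q -> marking Q S') C :
  (forall qp, qp \in C -> atom_sat (mu qp.1) qp.2) ->
  exists F : S' -> rel2,
    (forall c q q', (q, q') \in F c -> q \in map fst C /\ q' \in mu q c) /\
    exists cs cfg, [/\ cfg \in configurations C, uniq cs, perm_eq (map F cs) cfg
                     & forall c, c \notin cs -> F c \in free_relations C].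
Proof.
elim: C => [_|qp C IH sat].
  exists (fun=> set0); split=> [c q q'|]; first by rewrite inE.
  by exists [::], [::]; rewrite /= inE; split=> // c _; rewrite inE.
have [|G [Gmu [old [rho [hrho uold pold Gfree]]]]] := IH.
  by move=> qp' qp'C; apply: sat; rewrite inE qp'C orbT.
have [nu unu] := sat qp (mem_head _ _).
case/(mset_satP (p := pair_of_atom qp.2) nu (count_elements qp.2.1)) => new [unew enew nuU].
pose F c := (qp.1, nu c) |: G c.
exists F; split.
  move=> c q q'; rewrite !inE => /predU1P [[-> ->]|/Gmu [-> ->]]; last by rewrite orbT.
  by rewrite eqxx; split=> //; exact: unu.
have [||cs [ucs mcs [cfg hcfg pcfg]]] := @extend_complete S' qp.1 qp.2.2
    (free_relations C) rho G nu old new uold pold unew.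
- by move=> c _; exact: nuU.
- by move=> c _; exact: Gfree.
exists cs, cfg; split=> //.
  by apply/flatten_mapP; exists rho; rewrite // -enew.
move=> c; rewrite mcs !inE negb_or => /andP [cnew cold].
by apply/imsetP; exists (nu c, G c); rewrite // inE /= nuU // Gfree.
Qed.

Lemma fill_sound (S' : finType) q U rho cfg (F : S' -> rel2) cs :
  cfg \in fill q U rho -> uniq cs -> map F cs = cfg ->
  exists (nu : S' -> Q) (G : S' -> rel2),
    map G cs = rho /\ forall c, c \in cs -> F c = (q, nu c) |: G c /\ nu c \in U.
Proof.
elim: rho cfg cs => [|r rho IH] cfg [|c cs] /=; rewrite ?inE.
- by move=> _ _ _; exists (fun=> q), (fun=> set0).
- by move=> /eqP ->.
- by case/allpairsP=> [[u cfg'] [_ _ ->]].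
case/allpairsP=> [[u cfg'] [/= uU hcfg' ->]] /andP [ccs ucs] [Fc Fcs].
have [nu [G [GE h]]] := IH _ _ hcfg' ucs Fcs.
have nec c' : c' \in cs -> (c' == c) = false.
  by move=> c'cs; apply: contraNF ccs => /eqP <-.
exists (fun c' => if c' == c then u else nu c'), (fun c' => if c' == c then r else G c').
rewrite eqxx; split.
  by congr cons; rewrite -GE; apply/eq_in_map => c' /nec ->.
move=> c'; rewrite inE; case: eqVneq => [->|_ /h //].
by split; rewrite // -mem_enum.
Qed.

Lemma extend_sound (S' : finType) q U UU es rho cfg (F : S' -> rel2) cs :
  cfg \in extend q U UU es rho -> uniq cs -> map F cs = cfg ->
  exists (nu : S' -> Q) (G : S' -> rel2) old new,
  [/\ uniq old, {subset old <= cs} & perm_eq (map G old) rho] /\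
  [/\ uniq new, {subset new <= cs} & map nu new = es] /\
  forall c, c \in cs -> [/\ F c = (q, nu c) |: G c, c \notin new -> nu c \in U
                         & c \notin old -> G c \in UU].
Proof.
elim: es rho cfg cs => [|x es IH] rho cfg cs /=.
  move=> hcfg ucs Fcs; have [nu [G [GE h]]] := fill_sound hcfg ucs Fcs.
  exists nu, G, cs, [::]; split; first by rewrite GE; split.
  by split=> // c ccs; have [-> nuU] := h c ccs; rewrite ccs; split.
case: cs => [|c cs]; first by case/allpairsPdep=> [rr [cfg' [_ _ ->]]].
case/allpairsPdep=> [rr [cfg' [rr_opt hcfg' ->]]] /= /andP [ccs ucs] [Fc Fcs].
have [nu [G [old [new [[uold sold pold] [[unew snew enew] h]]]]]] := IH _ _ _ hcfg' ucs Fcs.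
have nec c' : c' \in cs -> (c' == c) = false.
  by move=> c'cs; apply: contraNF ccs => /eqP <-.
pose nu' c' := if c' == c then x else nu c'.
pose G' c' := if c' == c then rr.1 else G c'.
have G'old : map G' old = map G old.
  by apply/eq_in_map => c' /sold /nec; rewrite /G' => ->.
have [old' [uold' sold' pold' mold' cold']] : exists old',
    [/\ uniq old', {subset old' <= c :: cs}, perm_eq (map G' old') rho,
        forall c', c' \in old -> c' \in old' & c \notin old' -> rr.1 \in UU].
  move: rr_opt; rewrite mem_cat => /orP [] /mapP [r rin e].
    exists old; rewrite G'old; split=> //.
    - by move=> c' /sold c'cs; rewrite inE c'cs orbT.
    - by move: pold; rewrite e.
    by move=> _; rewrite e /= -mem_enum.
  exists (c :: old); split=> //=.
  - by rewrite uold andbT; apply: contra ccs => /sold.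
  - by move=> c'; rewrite !inE => /predU1P [->|/sold ->]; rewrite ?eqxx ?orbT.
  - rewrite G'old /G' eqxx; move: pold; rewrite e /= => pold.
    by rewrite (permPr (perm_to_rem rin)) perm_cons.
  - by move=> c' c'old; rewrite inE c'old orbT.
  by rewrite mem_head.
exists nu', G', old', (c :: new); split=> //; split; first split=> /=.
- by rewrite unew andbT; apply: contra ccs => /snew.
- by move=> c'; rewrite !inE => /predU1P [->|/snew ->]; rewrite ?eqxx ?orbT.
- rewrite /nu' eqxx -enew; congr cons.
  by apply/eq_in_map => c' /snew /nec ->.
move=> c'; rewrite inE => /predU1P [->|c'cs].
  by rewrite /nu' /G' eqxx mem_head; split.
rewrite /nu' /G' (nec _ c'cs); have [-> h1 h2] := h _ c'cs; split=> //.
  by rewrite inE negb_or => /andP [_]; exact: h1.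
by move=> c'old'; apply: h2; apply: contra c'old' => /mold'.
Qed.

(** Peeling the edge of the first atom off every relation leaves a configuration for the other
    atoms, whose satisfaction passes to the larger relations by monotonicity. *)
Lemma configurations_sound (S' : finType) C cfg (F : S' -> rel2) cs :
  cfg \in configurations C -> uniq cs -> map F cs = cfg ->
  (forall c, c \notin cs -> F c \in free_relations C) ->
  forall qp, qp \in C -> atom_sat (fun c => [set q' | (qp.1, q') \in F c]) qp.2.
Proof.
elim: C cfg cs F => // qp0 C IH cfg cs F /flatten_mapP [rho hrho hcfg] ucs Fcs Ffree.
have [nu [G [old [new [[uold sold pold] [[unew snew enew] h]]]]]] :=
  extend_sound hcfg ucs Fcs.
have /choice [ur hur] c : exists ur : Q * rel2, c \notin cs ->
    [/\ ur.1 \in qp0.2.2, ur.2 \in free_relations C & F c = (qp0.1, ur.1) |: ur.2].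
  have [ccs|ccs] := boolP (c \in cs); first by exists (qp0.1, set0).
  have /imsetP [ur + e] := Ffree c ccs.
  by rewrite inE => /andP [h1 h2]; exists ur.
pose nu' c := if c \in cs then nu c else (ur c).1.
pose G' c := if c \in cs then G c else (ur c).2.
have FE c : F c = (qp0.1, nu' c) |: G' c.
  rewrite /nu' /G'; case: ifPn => ccs; first by have [] := h c ccs.
  by have [] := hur c ccs.
have [old' pold' Gold'] := perm_map_lift pold.
have G'old' : map G' old' = rho.
  rewrite -Gold'; apply/eq_in_map => c; rewrite -(perm_mem pold') /G' => /sold -> //.
move=> qp; rewrite inE => /predU1P [->|qpC].
  exists nu'; first by move=> c; rewrite inE FE setU11.
  apply/(mset_satP (p := pair_of_atom qp0.2) _ (count_elements qp0.2.1)); exists new; split=> //.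
    by rewrite -enew; apply/eq_in_map => c /snew; rewrite /nu' => ->.
  move=> c cnew; rewrite /nu'; case: ifPn => ccs; last by have [] := hur c ccs.
  by have [_ + _] := h c ccs; exact.
apply: atom_sat_mono (IH rho old' G' hrho _ G'old' _ qp qpC).
- by move=> c; apply/subsetP => q'; rewrite !inE FE !inE => ->; rewrite orbT.
- by rewrite -(perm_uniq pold').
move=> c; rewrite -(perm_mem pold') /G' => cold; case: ifPn => ccs.
  by have [_ _] := h c ccs; exact.
by have [] := hur c ccs.
Qed.

End Rows.

(** * Number and size of configurations *)

Section ConfigurationBounds.
Variables (Q : finType) (e u : nat).
Implicit Type C : seq (Q * atom Q).

Definition atoms_bounded C : Prop :=
  forall qp, qp \in C -> mcard qp.2.1 <= e /\ #|qp.2.2| <= u.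

Lemma atoms_bounded_cons qp C : atoms_bounded (qp :: C) ->
  [/\ mcard qp.2.1 <= e, #|qp.2.2| <= u & atoms_bounded C].
Proof.
move=> h; have [h1 h2] := h _ (mem_head _ _); split=> // qp' qp'C.
by apply: h; rewrite inE qp'C orbT.
Qed.

Lemma size_configuration C cfg : atoms_bounded C -> cfg \in configurations C ->
  size cfg <= size C * e.
Proof.
elim: C cfg => [|qp C IH] cfg; first by rewrite /= inE => _ /eqP ->.
case/atoms_bounded_cons=> he _ hC /flatten_mapP [rho hrho /size_extend_row h].
rewrite mulSn; apply: leq_trans h _; rewrite size_elements leq_add //.
exact: IH hC hrho.
Qed.

Lemma card_free_relations C : atoms_bounded C -> #|free_relations C| <= u ^ size C.
Proof.
elim: C => [_|qp C IH /atoms_bounded_cons [_ hu hC]]; first by rewrite cards1.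
by rewrite /= (leq_trans (leq_imset_card _ _)) // cardsX expnS leq_mul // IH.
Qed.

(** This is [B_bound] without the factor that counts clauses, for a clause of [i] atoms. *)
Definition configuration_bound i :=
  ((i - 1)`! * (e + 1) ^ (i - 1) * (maxn 1 u) ^ (i ^ 2)) ^ e.

Lemma configuration_bound_mono i j :
  i <= j -> configuration_bound i <= configuration_bound j.
Proof.
move=> ij; rewrite /configuration_bound; case: (posnP e) => [->//|e0].
have ij1 := leq_sub2r 1 ij.
by rewrite leq_exp2r // !leq_mul ?leq_fact ?leq_pexp2l ?addn1 ?leq_max ?leq_exp2r.
Qed.

Lemma configuration_bound_gt0 i : 0 < configuration_bound i.
Proof.
by rewrite expn_gt0 !muln_gt0 fact_gt0 !expn_gt0 addn1 leq_max.
Qed.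

(* Adding an atom to i others: each of its at most e singled out states goes to one
   of at most i * e singled out children or to one of at most u ^ i free relations,
   and the singled out children that are left receive a state of U. *)
Lemma configuration_boundS i :
  configuration_bound i * ((i * e + (maxn 1 u) ^ i) ^ e * (maxn 1 u) ^ (i * e))
  <= configuration_bound i.+1.
Proof.
set w := maxn 1 u; have w0 : 0 < w by rewrite leq_max.
have wi : 0 < w ^ i by rewrite expn_gt0 w0.
rewrite /configuration_bound -/w [w ^ (i * e)]expnM -!expnMn;
case: (posnP e) => [->//|e0]; rewrite leq_exp2r //.
rewrite subn1 /=; case: i wi => [|i] wi.
  by rewrite fact0 !expn0 !exp1n expn1 !mul0n !muln1 !mul1n.
rewrite subn1 /= factS expnS.
(* The exponent grows by [2 * i.+1 + 1]: one factor [w ^ i.+1] pays for the free relations, one for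
   filling the row, and one [w] is spare. *)
have -> : w ^ i.+2 ^ 2 = w ^ (i.+1 ^ 2) * (w ^ i.+1 * w ^ i.+1 * w ^ 1).
  by rewrite -!expnD; congr (_ ^ _); lia.
have h : i.+1 * e + w ^ i.+1 <= i.+1 * (e + 1) * w ^ i.+1.
  by move: wi; set W := w ^ i.+1; nia.
apply: leq_trans (leq_mul (leqnn _) (leq_mul h (leqnn _))) _.
set W := w ^ i.+1; set W2 := w ^ (i.+1 ^ 2).
apply: (@leq_trans (i.+1 * i`! * ((e + 1) * (e + 1) ^ i) * (W2 * (W * W * 1)))).
  by rewrite muln1; apply/eq_leq; lia.
by rewrite !leq_mul // -expnS.
Qed.

Lemma size_configurations C : atoms_bounded C ->
  size (configurations C) <= configuration_bound (size C).
Proof.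
elim: C => [_|qp C IH /atoms_bounded_cons [he hu hC]].
  exact: configuration_bound_gt0.
apply: leq_trans (configuration_boundS _); set w := maxn 1 u.
rewrite size_flatten /shape -map_comp sumnE big_map /=.
apply: leq_trans (leq_mul (IH hC) (leqnn _)); apply: leq_sum_size => rho hrho /=.
apply: leq_trans (size_extend _ _ _ _ _) _.
have hs := size_configuration hC hrho.
have hf : #|free_relations C| <= w ^ size C.
  apply: leq_trans (card_free_relations hC) _.
  by case: (size C) => // k; rewrite leq_exp2r // leq_maxr.
have w0 : 0 < w by rewrite leq_max.
apply: leq_mul.
  apply: (@leq_trans ((size C * e + w ^ size C) ^ size (elements qp.2.1))).
    by case: (size (elements _)) => // k; rewrite leq_exp2r // leq_add.
  by rewrite leq_pexp2l ?size_elements // addn_gt0 expn_gt0 w0 orbT.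
apply: (@leq_trans (w ^ size rho)); last by rewrite leq_pexp2l.
case: (size rho) => // k; rewrite leq_exp2r // /w; lia.
Qed.

End ConfigurationBounds.

(** * Transition constraints of the simulating automaton *)

Section Transition.
Variables (Q S2 : finType) (dl : Q -> eu_constraint Q) (nxt : {set Q * Q} -> S2).
Implicit Types (qs : seq Q) (C : seq (Q * atom Q)).

Fixpoint clauses qs : seq (seq (Q * atom Q)) :=
  if qs is q :: qs' then
    [seq [seq (q, p) | p <- K] ++ C | K <- dnf (dl q), C <- clauses qs']
  else [:: [::]].

Definition clause_atoms C : seq (atom S2) :=
  [seq (mset_of (map nxt cfg), nxt @: free_relations C) | cfg <- configurations C].

Definition transition_atoms qs : seq (atom S2) := flatten (map clause_atoms (clauses qs)).

(* An empty clause requires nothing of the children, and subsumes the others. *)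
Definition transition qs : eu_constraint S2 :=
  if [::] \in clauses qs then EUTop else disjunction (transition_atoms qs).

Lemma nonalternating_transition qs : nonalternating_constraint (transition qs).
Proof. by rewrite /transition; case: ifP => // _; exact: nonalternating_disjunction. Qed.

Lemma clauses_sat (S' : finType) (nu : Q -> marking Q S') qs :
  (forall q, q \in qs -> marking_sat (nu q) (dl q)) <->
  exists2 C, C \in clauses qs & forall qp, qp \in C -> atom_sat (nu qp.1) qp.2.
Proof.
elim: qs => [|q qs IH] /=; first by split=> // _; exists [::].
split=> [sat|[_ /allpairsP [[C D] [/= hC hD ->]] h] q'].
  have [|D hD satD] := IH.1; first by move=> q' hq'; apply: sat; rewrite inE hq' orbT.
  have /dnfP [C hC satC] := sat q (mem_head _ _).
  exists ([seq (q, p) | p <- C] ++ D); first by apply/allpairsP; exists (C, D).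
  by move=> qp; rewrite mem_cat => /orP [/mapP [p pC ->]|]; [exact: satC | exact: satD].
rewrite inE => /predU1P [->|q'qs].
  apply/dnfP; exists C => // p pC; apply: (h (q, p)).
  by rewrite mem_cat map_f.
apply: IH.2 q' q'qs; exists D => // qp qpD; apply: h.
by rewrite mem_cat qpD orbT.
Qed.

Lemma clauses_mem qs C qp : C \in clauses qs -> qp \in C ->
  qp.1 \in qs /\ exists2 C', C' \in dnf (dl qp.1) & qp.2 \in C'.
Proof.
elim: qs C => [|q qs IH] C /=; first by rewrite inE => /eqP ->.
case/allpairsP=> [[C' D] [/= hC hD ->]]; rewrite mem_cat => /orP [/mapP [p pC ->]|].
  by rewrite mem_head; split=> //; exists C'.
by case/(IH _ hD)=> h1 h2; rewrite inE h1 orbT.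
Qed.

Lemma transition_complete (S' : finType) (mu : Q -> marking Q S') qs :
  (forall q, q \in qs -> marking_sat (mu q) (dl q)) ->
  exists F : S' -> {set Q * Q},
    (forall c q q', (q, q') \in F c -> q \in qs /\ q' \in mu q c) /\
    marking_sat (fun c => [set nxt (F c)]) (transition qs).
Proof.
move=> /clauses_sat [C hC sat]; rewrite /transition.
case: ifP => [_|_]; first by exists (fun=> set0); split=> // c q q'; rewrite inE.
have [F [Fmu [cs [cfg [hcfg ucs pcfg Ffree]]]]] := configurations_complete sat.
exists F; split.
  move=> c q q' /Fmu [/mapP [qp qpC ->] ->]; split=> //.
  by have [] := clauses_mem hC qpC.
apply/disjunction_sat.
exists (mset_of (map nxt cfg), nxt @: free_relations C).
  by apply/flatten_mapP; exists C => //; apply/mapP; exists cfg.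
exists (fun c => nxt (F c)); first by move=> c; rewrite inE.
have [cs' pcs Fcs'] := perm_map_lift pcfg.
apply/mset_of_satP; exists cs'; split; first by rewrite -(perm_uniq pcs).
  by rewrite -Fcs' -map_comp.
by move=> c; rewrite -(perm_mem pcs) => /Ffree h; exact: imset_f.
Qed.

(** The alternative [F c = set0] covers [EUTop], under which a child may carry no state at all; no
    trace passes through such a child. *)
Lemma transition_sound (S' : finType) (mu : marking S2 S') qs :
  marking_sat mu (transition qs) ->
  exists F : S' -> {set Q * Q},
    (forall q, q \in qs -> marking_sat (fun c => [set q' | (q, q') \in F c]) (dl q)) /\
    forall c, F c = set0 \/ nxt (F c) \in mu c.
Proof.
rewrite /transition; case: ifP => [top _|_].
  exists (fun=> set0); split; last by left.
  by apply/clauses_sat; exists [::].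
case/disjunction_sat=> _ /flatten_mapP [C hC /mapP [cfg hcfg ->]] [nu unu].
case/mset_of_satP=> cs [ucs nucs nuU].
(* [nxt] may identify relations, so one with the right image is chosen: from [cfg] for the singled
   out children, free for the others. *)
have /choice [F hF] c : exists r, [/\ nxt r = nu c,
    c \in cs -> r = nth set0 cfg (index c cs) & c \notin cs -> r \in free_relations C].
  have [ccs|ccs] := boolP (c \in cs); last first.
    by have /imsetP [r rC ->] := nuU c ccs; exists r.
  exists (nth set0 cfg (index c cs)); split=> //.
  have sz : size cs = size cfg by rewrite -(size_map nu) nucs size_map.
  have ic : index c cs < size cs by rewrite index_mem.
  by rewrite -(nth_map set0 (nu c)) -?sz // -nucs (nth_map c) // nth_index.
exists F; split; last by move=> c; right; have [-> _ _] := hF c; exact: unu.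
apply/clauses_sat; exists C => //; apply: (configurations_sound hcfg ucs).
  have sz : size cs = size cfg by rewrite -(size_map nu) nucs size_map.
  apply: (@eq_from_nth _ set0); rewrite size_map // => i ics.
  have c0 : S' by case: (cs) ics.
  have [_ Fi _] := hF (nth c0 cs i).
  by rewrite (nth_map c0) // Fi ?mem_nth // index_uniq.
by move=> c; have [_ _] := hF c.
Qed.

Section Bounds.
Variables (B e u : nat).
Hypothesis hB : forall q, eu_size (dl q) <= B.
Hypothesis hE : forall q, \max_(p <- eu_pairs (dl q)) mcard (eu_E p) <= e.
Hypothesis hU : forall q, \max_(p <- eu_pairs (dl q)) #|eu_U p| <= u.

Lemma size_clauses qs : size (clauses qs) <= 2 ^ (size qs * (B - 1)).
Proof.
elim: qs => //= q qs IH; rewrite size_allpairs mulSn expnD leq_mul //.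
by apply: leq_trans (size_dnf _) _; rewrite leq_exp2l // leq_sub2r.
Qed.

Lemma size_clause qs C : C \in clauses qs -> size C <= size qs * B.
Proof.
elim: qs C => [|q qs IH] C /=; first by rewrite inE => /eqP ->.
case/allpairsP=> [[C' D] [/= hC hD ->]]; rewrite size_cat size_map mulSn leq_add ?IH //.
exact: leq_trans (size_dnf_clause hC) (hB q).
Qed.

Lemma clauses_bounded qs C : C \in clauses qs -> atoms_bounded e u C.
Proof.
move=> hC qp /(clauses_mem hC) [_ [C' hC' pC']]; split.
  by apply: leq_trans (hE qp.1); exact: (dnf_atom_le (fun p => mcard (eu_E p)) hC' pC').
by apply: leq_trans (hU qp.1); exact: (dnf_atom_le (fun p => #|eu_U p|) hC' pC').
Qed.

Lemma transition_atoms_le qs p : p \in transition_atoms qs ->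
  mcard p.1 <= size qs * B * e.
Proof.
case/flatten_mapP=> C hC /mapP [cfg hcfg ->] /=; rewrite mcard_mset_of size_map.
apply: leq_trans (size_configuration (clauses_bounded hC) hcfg) _.
by rewrite leq_mul // size_clause.
Qed.

(** An empty clause would contribute the empty relation, which exceeds [u ^ N] when [u = 0] and [N]
    is positive; [transition] turns that case into [EUTop]. *)
Lemma transition_atoms_free_le N qs p : [::] \notin clauses qs -> size qs * B <= N ->
  p \in transition_atoms qs -> #|p.2| <= u ^ N.
Proof.
move=> top qsN /flatten_mapP [C hC /mapP [cfg hcfg ->]] /=.
apply: leq_trans (leq_imset_card _ _) _.
apply: leq_trans (card_free_relations (clauses_bounded hC)) _.
have C0 : 0 < size C by case: C hC hcfg => // hC; rewrite hC in top.
case: (posnP u) => [->|u0]; first by rewrite exp0n.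
by rewrite leq_pexp2l // (leq_trans (size_clause hC)).
Qed.

(** There are at most [2 ^ (N - 1)] clauses, and the remaining factor 2 pays for the [EUOr]
    nodes. *)
Lemma eu_size_transition N qs : 0 < N -> size qs * (B - 1) < N -> size qs * B <= N ->
  eu_size (transition qs) <= 2 ^ N * configuration_bound e u N.
Proof.
move=> N0 qsN1 qsN.
have pos : 0 < 2 ^ N * configuration_bound e u N.
  by rewrite muln_gt0 expn_gt0 configuration_bound_gt0.
rewrite /transition; case: ifP => // _; apply: leq_trans (eu_size_disjunction _) _.
rewrite geq_max pos /= -(prednK N0) [in 2 ^ _]expnS -mulnA leq_pmul2l // prednK //.
rewrite size_flatten /shape -map_comp sumnE big_map.
apply: (@leq_trans (size (clauses qs) * configuration_bound e u N)).
  apply: leq_sum_size => C hC /=; rewrite size_map.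
  apply: leq_trans (size_configurations (clauses_bounded hC)) _.
  by apply: configuration_bound_mono; apply: leq_trans (size_clause hC) _.
rewrite leq_mul //; apply: leq_trans (size_clauses _) _.
by rewrite leq_exp2l //; lia.
Qed.

End Bounds.
End Transition.

(** * The simulating automaton *)

Section LocalTree.
Variables (Sigma : finType) (A : aapta Sigma) (T : labelled_tree Sigma).
Variable ok : seq (dir T) -> state A -> dir T -> state A -> bool.

Fixpoint follow m q (x : exec_word A T) : bool :=
  if x is (d, q') :: x' then
    [&& tree T (rcons m d), ok m q d q' & follow (rcons m d) q' x']
  else true.

Lemma follow_cat m q x z : follow m q (x ++ z) -> follow m q x.
Proof.
by elim: x m q => [|[d q'] x IH] m q //= /and3P [-> -> /IH].
Qed.

Lemma follow_rcons m q x d q' : follow m q (rcons x (d, q')) =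
  [&& follow m q x, tree T (rcons (m ++ unzip1 x) d)
    & ok (m ++ unzip1 x) (last q (unzip2 x)) d q'].
Proof.
elim: x m q => [|[d0 q0] x IH] m q /=; first by rewrite cats0 andbT.
by rewrite IH cat_rcons !andbA.
Qed.

(** Trees given by a condition on single steps are prefix-closed at once; both halves of the
    simulation build their execution trees this way. *)
Definition local_tree : dtree (dir T * state A)%type :=
  @DTree _ (follow [::] (init A)) isT (@follow_cat [::] (init A)).

Lemma local_tree_rcons x d q : local_tree (rcons x (d, q)) =
  [&& local_tree x, tree T (rcons (exec_node x) d) & ok (exec_node x) (exec_state x) d q].
Proof. exact: follow_rcons. Qed.

Lemma local_tree_node x : local_tree x -> tree T (exec_node x).
Proof.
elim/last_ind: x => [_|x [d q] _]; first exact: node_root.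
by rewrite local_tree_rcons exec_node_rcons => /and3P [].
Qed.

End LocalTree.

Lemma exec_node_mkseq (Sigma : finType) (A : aapta Sigma) (T : labelled_tree Sigma)
    (b : nat -> dir T * state A) i :
  exec_node (mkseq b i) = mkseq (fun i => (b i).1) i.
Proof. by rewrite /exec_node /unzip1 /mkseq -map_comp. Qed.

Lemma exec_state_mkseqS (Sigma : finType) (A : aapta Sigma) (T : labelled_tree Sigma)
    (b : nat -> dir T * state A) i :
  exec_state (mkseq b i.+1) = (b i).2.
Proof. by rewrite mkseqS; case: (b i) => d q; rewrite exec_state_rcons. Qed.

Section Simulation.
Variables (Sigma : finType) (A : aapta Sigma).
Local Notation Q := (state A).
Variables (D : finType) (d0 : D) (step : D -> {set Q * Q} -> D) (pr : D -> nat).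
Hypothesis trace_correct : forall a : nat -> {set Q * Q},
  parity_even (fun n => pr (foldl step d0 (mkseq a n))) <->
  forall q : nat -> Q, q 0 = init A -> (forall i, (q i, q i.+1) \in a i) ->
    parity_even (fun i => priority A (q i)).

(** The relation along an edge is not stored, only its image and its effect on the word
    automaton. *)
Definition sim_state : finType := ({set Q} * D)%type.

Definition sim_next (d : D) (R : {set Q * Q}) : sim_state :=
  ([set qq.2 | qq in R], step d R).

Definition simulation : aapta Sigma :=
  @AAPTA Sigma sim_state ([set init A], d0)
    (fun s a => transition (fun q => delta A q a) (sim_next s.2) (enum s.1))
    (fun s => pr s.2).

Variable T : labelled_tree Sigma.

(** One thread suffices: after fixing relations [R], [run] selects one execution word above each
    word of directions, and the tree for [A] follows the relations met there. *)
Lemma simulation_sound : language simulation T -> language A T.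
Proof.
move=> [e' exe acc].
have /choice [R hR] (y : exec_word simulation T) : exists R : dir T -> {set Q * Q}, e' y ->
    (forall q, q \in (exec_state y).1 ->
      marking_sat (fun d : successor (exec_node y) => [set q' | (q, q') \in R (val d)])
        (delta A q (label T (exec_node y)))) /\
    forall d, tree T (rcons (exec_node y) d) ->
      R d = set0 \/ e' (rcons y (d, sim_next (exec_state y).2 (R d))).
  have [e'y|] := boolP (e' y); last by exists (fun=> set0).
  have [_ /transition_sound [F [Fsat Fe]]] := exe y e'y.
  exists (fun d => if insub d is Some d' then F d' else set0) => _.
  split=> [q qy|d hd]; last first.
    by rewrite insubT; have := Fe (Sub d hd); rewrite inE.
  have := Fsat q; rewrite mem_enum => /(_ qy); congr (marking_sat _ _).
  by apply: funext => d; rewrite valK.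
pose nxt (y : exec_word simulation T) d := rcons y (d, sim_next (exec_state y).2 (R y d)).
pose run (w : seq (dir T)) := foldl nxt [::] w.
have run_rcons w d : run (rcons w d) = nxt (run w) d by rewrite /run foldl_rcons.
have run_node w : exec_node (run w) = w.
  by elim/last_ind: w => // w d IH; rewrite run_rcons /nxt exec_node_rcons IH.
pose e := local_tree (fun w q d q' => (q, q') \in R (run w) d).
have inv x : e x -> e' (run (exec_node x)) /\ exec_state x \in (exec_state (run (exec_node x))).1.
  elim/last_ind: x => [_|x [d q'] IH]; first by rewrite set11; split=> //; exact: node_root.
  rewrite /e local_tree_rcons -/e => /and3P [/IH [e'y qy] td qR].
  rewrite exec_node_rcons exec_state_rcons run_rcons /nxt exec_state_rcons.
  have [_] := hR _ e'y; rewrite run_node => /(_ d td) [R0|h].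
    by move: qR; rewrite R0 inE.
  by split=> //; apply/imsetP; exists (exec_state x, q').
exists e.
  move=> x ex; split; first exact: local_tree_node ex.
  have [e'y qy] := inv x ex; have [+ _] := hR _ e'y => /(_ _ qy).
  rewrite run_node; congr (marking_sat _ _). apply: funext => d.
  apply/setP => q'; rewrite !inE /e local_tree_rcons -/e ex.
  by rewrite (valP d).
move=> b eb; pose ds i := (b i).1; pose y i := run (mkseq ds i).
pose a i := R (y i) (ds i).
have yS i : y i.+1 = rcons (y i) (ds i, sim_next (exec_state (y i)).2 (a i)).
  by rewrite /y mkseqS run_rcons.
pose b' i : dir T * state simulation := (ds i, sim_next (exec_state (y i)).2 (a i)).
have b'y i : mkseq b' i = y i by elim: i => // i IH; rewrite mkseqS IH yS.
have /acc : infinite_branch e' b'.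
  by move=> i; rewrite b'y; have [] := inv _ (eb i); rewrite exec_node_mkseq.
have st i : (exec_state (y i)).2 = foldl step d0 (mkseq a i).
  by elim: i => // i IH; rewrite yS exec_state_rcons mkseqS foldl_rcons /= IH.
rewrite (_ : (fun i => _) = (fun i => pr (foldl step d0 (mkseq a i)))); last first.
  by apply: funext => i; rewrite b'y -st.
move/trace_correct; apply=> // i.
have := eb i.+1; rewrite mkseqS [b i]surjective_pairing /e local_tree_rcons exec_state_rcons.
by rewrite exec_node_mkseq => /and3P [].
Qed.

(** Every state in the current set satisfies [W], so the moves of [sg] serve all of them at once,
    and each trace through the resulting relations is a play of [sg]. *)
Lemma simulation_complete : language A T -> language simulation T.
Proof.
case/positional_strategy=> W [sg [W0 Wsg plays]].
have /choice [R hR] (ms : seq (dir T) * sim_state) : exists R : dir T -> {set Q * Q},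
    (forall q, q \in ms.2.1 -> W ms.1 q) ->
    (forall d q q', (q, q') \in R d -> q \in ms.2.1 /\ q' \in sg ms.1 q d) /\
    marking_sat (fun d : successor ms.1 => [set sim_next ms.2.2 (R (val d))])
      (delta simulation ms.2 (label T ms.1)).
  case: ms => m s /=.
  have [Wm|nW] := EM (forall q, q \in s.1 -> W m q); last by exists (fun=> set0) => /nW.
  have [q|F [Fsg Fsat]] := @transition_complete _ _ (fun q => delta A q (label T m))
      (sim_next s.2) (successor m) (fun q d => sg m q (val d)) (enum s.1).
    by rewrite mem_enum => /Wm /Wsg [].
  exists (fun d => if insub d is Some d' then F d' else set0) => _; split.
    move=> d q q'; case: insubP => [d' _ <-|_]; last by rewrite inE.
    by move/Fsg; rewrite mem_enum.
  move: Fsat; congr (marking_sat _ _); apply: funext => d.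
  by rewrite valK.
pose e := @local_tree Sigma simulation T
  (fun w s d s' => s' == sim_next s.2 (R (w, s) d)).
have inv x : e x -> forall q, q \in (exec_state x).1 -> W (exec_node x) q.
  elim/last_ind: x => [_ q|x [d s] IH]; first by rewrite inE => /eqP ->.
  rewrite /e local_tree_rcons -/e => /and3P [/IH Wx _ /eqP ->] q'.
  rewrite exec_node_rcons exec_state_rcons => /imsetP [[q q''] qR ->] /=.
  have [+ _] := hR (exec_node x, exec_state x) Wx => /(_ _ _ _ qR) [qx q's].
  by have [_ _] := Wsg _ _ (Wx _ qx); apply.
exists e.
  move=> x ex; split; first exact: local_tree_node ex.
  have [_] := hR (exec_node x, exec_state x) (inv _ ex).
  congr (marking_sat _ _); apply: funext => d; apply/setP => s'.
  by rewrite !inE /e local_tree_rcons -/e ex (valP d).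
move=> b eb; pose ds i := (b i).1; pose x i := mkseq b i.
pose a i := R (exec_node (x i), exec_state (x i)) (ds i).
have bS i : (b i).2 = sim_next (exec_state (x i)).2 (a i).
  have := eb i.+1; rewrite mkseqS [b i]surjective_pairing /e local_tree_rcons.
  by case/and3P=> _ _ /eqP.
have st i : (exec_state (x i)).2 = foldl step d0 (mkseq a i).
  by elim: i => // i IH; rewrite exec_state_mkseqS bS mkseqS foldl_rcons -IH.
rewrite (_ : (fun i => _) = (fun i => pr (foldl step d0 (mkseq a i)))); last first.
  by apply: funext => i; rewrite -st.
apply/trace_correct => q q0 qa; apply: (plays ds) q0 _ => i.
have [+ _] := hR (exec_node (x i), exec_state (x i)) (inv _ (eb i)).
by move=> /(_ _ _ _ (qa i)) [_]; rewrite exec_node_mkseq.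
Qed.

End Simulation.

Theorem theorem4 (Sigma : finType) (A : aapta Sigma) :
  let N := nb_states A * delta_B A in
  exists A' : aapta Sigma,
    [/\ nonalternating A',
        forall T : labelled_tree Sigma, language A' T <-> language A T
      & [/\ nb_states A' <= state_bound (nb_states A) (nb_priorities A),
            delta_B A' <= B_bound N (delta_E A) (delta_U A),
            delta_E A' <= N * delta_E A,
            delta_U A' <= delta_U A ^ N
          & nb_priorities A' <= 2 * (nb_states A * nb_priorities A + 1)]].
Proof.
move=> N.
have [D [d0 [step [pr [cardD prD correct]]]]] := trace_automaton (init A) (priority A).
exists (simulation d0 step pr); split.
- by move=> s a; exact: nonalternating_transition.
- by move=> T; split; [exact: simulation_sound | exact: simulation_complete].
set n := nb_states A; set w := nb_priorities A.
have n0 : 0 < n by apply/card_gt0P; exists (init A).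
have hB a q : eu_size (delta A q a) <= delta_B A.
  by apply: leq_trans (leq_bigmax q); exact: (leq_bigmax a).
have hE a q : \max_(p <- eu_pairs (delta A q a)) mcard (eu_E p) <= delta_E A.
  by apply: leq_trans (leq_bigmax q); exact: (leq_bigmax a).
have hU a q : \max_(p <- eu_pairs (delta A q a)) #|eu_U p| <= delta_U A.
  by apply: leq_trans (leq_bigmax q); exact: (leq_bigmax a).
have size_qs (X : {set state A}) : size (enum X) <= n by rewrite -cardE max_card.
have qsN X : size (enum (X : {set state A})) * delta_B A <= N.
  by rewrite leq_mul ?size_qs.
(* [delta_B] is a maximum over letters as well, so it is positive only in the presence of a
   letter. *)
have B0 (a : Sigma) : 0 < delta_B A.
  exact: leq_trans (eu_size_gt0 _) (hB a (init A)).
split.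
- rewrite /nb_states card_prod -[#|{set _}|]cardsT -powersetT card_powerset cardsT.
  apply: leq_trans (leq_mul (leqnn _) cardD) _.
  rewrite -/n -/w /state_bound; have nn : n <= n ^ 2 by rewrite leq_pmulr.
  (* The factor [2 * (n * w) + 1] is at most [2 * k ^ 2]: its 2 is the 1 in the exponent
     [1 + n ^ 2], and [k ^ 2] raises [k ^ (2 * (n * w))] to [k ^ (2 * k)]. *)
  set k := n * w + 1; apply: (@leq_trans (2 ^ (n ^ 2) * (k ^ (2 * (n * w)) * (2 * k ^ 2)))).
    rewrite leq_mul ?leq_exp2l //; rewrite leq_mul //.
    apply: (@leq_trans (2 * k)); first by rewrite /k mulnDr leq_add2l.
    by rewrite leq_mul // leq_pmulr // /k addn1.
  have -> : 2 * k = 2 * (n * w) + 2 by rewrite /k mulnDr.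
  by rewrite !expnD expn1 [_ * (2 * _)]mulnCA mulnCA mulnA.
- apply/bigmax_leqP => s _; apply/bigmax_leqP => a _.
  apply: (eu_size_transition _ (hB a) (hE a) (hU a)) => //.
  + by rewrite muln_gt0 n0 (B0 a).
  + apply: (@leq_ltn_trans (n * (delta_B A - 1))); first by rewrite leq_mul ?size_qs.
    by rewrite ltn_pmul2l // subn1 ltn_predL (B0 a).
- apply/bigmax_leqP => s _; apply/bigmax_leqP => a _ /=; rewrite /transition.
  case: ifP => [_|_]; first by rewrite big_nil.
  rewrite eu_pairs_disjunction big_map; apply/bigmax_leqP_seq => p pin _ /=.
  apply: leq_trans (transition_atoms_le (hB a) (hE a) (hU a) pin) _.
  by rewrite leq_mul.
- apply/bigmax_leqP => s _; apply/bigmax_leqP => a _ /=; rewrite /transition.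
  case: ifPn => [_|top]; first by rewrite big_nil.
  rewrite eu_pairs_disjunction big_map; apply/bigmax_leqP_seq => p pin _ /=.
  exact: (transition_atoms_free_le (hB a) (hE a) (hU a) top (qsN s.1) pin).
rewrite /nb_priorities -[leqRHS](size_iota 0); apply: uniq_leq_size; first exact: undup_uniq.
move=> p; rewrite mem_undup => /codomP [s ->]; rewrite mem_iota /= add0n.
by apply: leq_ltn_trans (prD s.2) _; rewrite ltn_pmul2l // -/n -/w addn1.
Qed.
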